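(* Let $\ell$ be a commutative ring with unit. Let $G$ be a finite group acting freely on a finite simplicial set $X$. Then $\ell^X\rtimes G$ and $\ell^{X/G}$ are $kk$-equivalent, that is, $j(\ell^X\rtimes G)\cong j(\ell^{X/G})$ in $kk$.
   Context: A simplicial set is finite if it has finitely many non-degenerate simplices. $G$ acts on $X$ by simplicial automorphisms, freely meaning $g\cdot\sigma\ne\sigma$ for every simplex $\sigma$ and $g\neq e$; $X/G$ is the quotient simplicial set. $\ell^{\Delta}$ is the simplicial ring $[n]\mapsto \ell^{\Delta^n}=\ell[t_0,\dots,t_n]/\langle t_0+\cdots+t_n-1\rangle$, where $\alpha:[m]\to[n]$ acts by $t_i\mapsto\sum_{\alpha(j)=i}t_j$, and $\ell^X=\hom_{\mathbf{sSet}}(X,\ell^\Delta)$ with pointwise operations (piecewise polynomial functions). $G$ acts on $\ell^X$ by $(g\cdot\phi)(\sigma)=\phi(g^{-1}\cdot\sigma)$. For a $G$-algebra $A$, $A\rtimes G=A\otimes_\ell\ell[G]$ as a module, with product $(a\rtimes g)(b\rtimes h)=a(g\cdot b)\rtimes gh$. $\mathbf{Alg}$ is the category of associative, not necessarily unital $\ell$-algebras. A functor on $\mathbf{Alg}$ is (polynomially) homotopy invariant if it inverts the inclusion of constants $A\to A[t]$ for all $A$; it is matrix stable if it inverts the upper-left corner inclusion $A\to M_{\mathbb N}A$ for all $A$, $M_{\mathbb N}A$ being the algebra of finitely supported $\mathbb N\times\mathbb N$ matrices over $A$. An extension is a short exact sequence $A\to B\to C$ of algebras admitting an $\ell$-linear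 section $C\to B$. A functor $Y$ from $\mathbf{Alg}$ to a triangulated category $(\mathcal{T},\Omega)$, $\Omega$ being the desuspension, is excisive if it is equipped with morphisms $\partial_{\mathcal E}:\Omega Y(C)\to Y(A)$ for each extension $\mathcal E:A\to B\to C$, natural with respect to morphisms of extensions, such that $\Omega Y(C)\to Y(A)\to Y(B)\to Y(C)$ is a distinguished triangle. The algebraic bivariant $K$-theory $j:\mathbf{Alg}\to kk$ (Cortiñas–Thom) is the initial homotopy invariant, matrix stable, excisive functor: any other such functor factors uniquely through $j$ via a triangulated functor compatible with the boundary morphisms. *)

(* Defs.v *)
From HB Require Import structures.
From mathcomp Require Import all_boot all_order all_fingroup all_algebra.
From mathcomp Require Import generic_quotient ring_quotient finmap.
From mathcomp.multinomials Require Import monalg.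
From mathcomp Require Import boolp classical_sets cardinality.

Set Implicit Arguments.
Unset Strict Implicit.
Unset Printing Implicit Defensive.

Import GRing.Theory.

Local Open Scope ring_scope.

Declare Scope nualg_scope.
Delimit Scope nualg_scope with NA.
Local Open Scope nualg_scope.

HB.mixin Record Lmodule_isNuAlg (l : comPzRingType) A of GRing.Lmodule l A := {
  amul : A -> A -> A;
  amulA : associative amul;
  amulDl : left_distributive amul +%R;
  amulDr : right_distributive amul +%R;
  amulZl : forall (c : l) (a b : A), amul (c *: a) b = c *: amul a b;
  amulZr : forall (c : l) (a b : A), amul a (c *: b) = c *: amul a b
}.

#[short(type="nuAlgType")]
HB.structure Definition NuAlg (l : comPzRingType) :=
  {A of Lmodule_isNuAlg l A & GRing.Lmodule l A}.

Notation "a ** b" := (amul a b) (at level 40, left associativity) : nualg_scope.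

Section NuAlgTheory.
Variables (l : comPzRingType) (A : nuAlgType l).
Implicit Types a b : A.

Lemma amul0l a : 0 ** a = 0.
Proof. by apply: (addrI (0 ** a)); rewrite -amulDl !addr0. Qed.

Lemma amul0r a : a ** 0 = 0.
Proof. by apply: (addrI (a ** 0)); rewrite -amulDr !addr0. Qed.

Lemma amul_suml I (r : seq I) (P : pred I) (F : I -> A) a :
  (\sum_(i <- r | P i) F i) ** a = \sum_(i <- r | P i) (F i ** a).
Proof.
exact: (big_morph (fun x => x ** a) (fun x y => amulDl x y a) (amul0l a)).
Qed.

Lemma amul_sumr I (r : seq I) (P : pred I) (F : I -> A) a :
  a ** (\sum_(i <- r | P i) F i) = \sum_(i <- r | P i) (a ** F i).
Proof. exact: (big_morph (amul a) (amulDr a) (amul0r a)). Qed.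

End NuAlgTheory.

Section Regular.
Variable l : comPzRingType.

Fact regular_amulZr (c : l) (a b : l^o) :
  ((a : l) * (c *: b) : l) = (c *: (((a : l) * b) : l^o)) :> l.
Proof. exact: mulrCA. Qed.

HB.instance Definition _ := Lmodule_isNuAlg.Build l l^o
  (@mulrA l) (@mulrDl l) (@mulrDr l)
  (fun c a b => esym (mulrA (c : l) a b)) regular_amulZr.

End Regular.

Record alg_hom (l : comPzRingType) (A B : nuAlgType l) := AlgHom {
  alg_hom_fun :> A -> B;
  alg_hom_linear : linear alg_hom_fun;
  alg_homM : {morph alg_hom_fun : a b / a ** b}
}.

Lemma alg_hom_ext (l : comPzRingType) (A B : nuAlgType l) (f g : alg_hom A B) :
  f =1 g -> f = g.
Proof.
case: f g => [f lf mf] [g lg mg] /= /funext efg; rewrite efg in lf mf *.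
by congr AlgHom.
Qed.

Section AlgHomTheory.
Variables (l : comPzRingType) (A B : nuAlgType l) (f : alg_hom A B).

HB.instance Definition _ := GRing.isLinear.Build l A B *:%R f (alg_hom_linear f).

Lemma alg_hom0 : f 0 = 0. Proof. exact: raddf0. Qed.
Lemma alg_homN : {morph f : a / - a}. Proof. exact: raddfN. Qed.
Lemma alg_homD : {morph f : a b / a + b}. Proof. exact: raddfD. Qed.
Lemma alg_homB : {morph f : a b / a - b}. Proof. exact: raddfB. Qed.
Lemma alg_homZ (c : l) : {morph f : a / c *: a}. Proof. exact: linearZ. Qed.
Lemma alg_hom_sum I (r : seq I) (P : pred I) (F : I -> A) :
  f (\sum_(i <- r | P i) F i) = \sum_(i <- r | P i) f (F i).
Proof. exact: raddf_sum. Qed.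

End AlgHomTheory.

Definition alg_id (l : comPzRingType) (A : nuAlgType l) : alg_hom A A.
Proof. by exists id. Defined.

Definition alg_comp (l : comPzRingType) (A B C : nuAlgType l)
  (g : alg_hom B C) (f : alg_hom A B) : alg_hom A C.
Proof.
exists (g \o f) => [c a b|a b] /=.
- by rewrite !alg_hom_linear.
- by rewrite !alg_homM.
Defined.

(* Contracted semigroup algebras: a partial associative operation on [K] (that
   is, a semigroup with zero, the value [None] being the zero) turns the
   finitely supported functions from [K] to an algebra [A] into an algebra, with
   product (a k)(b k') = (ab)(k k'), which is 0 when k k' is not defined.  The
   monoid [nat] gives A[t], exponent vectors give polynomials in several
   variables, and the matrix units e_(i, j) give the finitely supported
   matrices. *)

Record partial_semigroup (K : choiceType) := PartialSemigroup {
  ps_op :> K -> K -> option K;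
  ps_opA : forall h i k : K,
    obind (ps_op h) (ps_op i k) = obind (fun x => ps_op x k) (ps_op h i)
}.

Definition sgalg (l : comPzRingType) (A : nuAlgType l) (K : choiceType)
  (op : partial_semigroup K) : Type := {malg A[K]}.

Section SemigroupAlgebra.
Variables (l : comPzRingType) (A : nuAlgType l) (K : choiceType).
Variable op : partial_semigroup K.
Local Notation T := (sgalg A op).
Implicit Types (c : l) (g : {malg A[K]}) (a b : A) (h i k : K).

HB.instance Definition _ := GRing.Zmodule.on T.

Definition sg_scale c g : {malg A[K]} := [malg k in msupp g => c *: g@_k].

Lemma sg_scaleE c g k : (sg_scale c g)@_k = c *: g@_k.
Proof. by rewrite mcoeffE; case: msuppP; rewrite ?scaler0. Qed.

Fact sg_scaleA c d g : sg_scale c (sg_scale d g) = sg_scale (c * d) g.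
Proof. by apply/malgP => k; rewrite !sg_scaleE scalerA. Qed.

Fact sg_scale1 : left_id 1 sg_scale.
Proof. by move=> g; apply/malgP => k; rewrite !sg_scaleE scale1r. Qed.

Fact sg_scaleDr : right_distributive sg_scale +%R.
Proof.
by move=> c g g'; apply/malgP => k; rewrite !(mcoeffD, sg_scaleE) scalerDr.
Qed.

Fact sg_scaleDl g : {morph sg_scale^~ g : c d / c + d}.
Proof.
by move=> c d; apply/malgP => k; rewrite !(mcoeffD, sg_scaleE) scalerDl.
Qed.

HB.instance Definition _ := GRing.Zmodule_isLmodule.Build l T
  sg_scaleA sg_scale1 sg_scaleDr sg_scaleDl.

Definition sg_term (a : A) (o : option K) : {malg A[K]} :=
  if o is Some k then << a *g k >> else 0.

Definition sg_mul g g' : {malg A[K]} :=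
  \sum_(h <- msupp g) \sum_(k <- msupp g') sg_term (g@_h ** g'@_k) (op h k).

Lemma sg_term0 (o : option K) : sg_term 0 o = 0.
Proof. by case: o => //= k; rewrite monalgU0. Qed.

Lemma sg_termD (o : option K) : {morph sg_term^~ o : a b / a + b}.
Proof. by case: o => [k|] a b /=; rewrite ?monalgUD ?addr0. Qed.

Lemma sg_termZ c a (o : option K) :
  sg_term (c *: a) o = sg_scale c (sg_term a o).
Proof.
case: o => [k|] /=; apply/malgP => i; rewrite !(sg_scaleE, mcoeff0, mcoeffU).
- by case: eqP; rewrite ?scaler0.
- by rewrite scaler0.
Qed.

Local Open Scope fset_scope.

Lemma sg_mulw (D D' : {fset K}) g g' : msupp g `<=` D -> msupp g' `<=` D' ->
  sg_mul g g' =
  \sum_(h <- D) \sum_(k <- D') sg_term (g@_h ** g'@_k) (op h k).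
Proof.
move=> leD leD'; rewrite /sg_mul (big_fset_incl _ leD) /=.
  apply: eq_bigr => h _; apply: big_fset_incl => // k _ /mcoeff_outdom ->.
  by rewrite amul0r sg_term0.
move=> h _ /mcoeff_outdom ->; rewrite big1 // => k _.
by rewrite amul0l sg_term0.
Qed.

Lemma sg_mulDl : left_distributive sg_mul +%R.
Proof.
move=> g1 g2 g; rewrite (sg_mulw (msuppD_le _ _) (fsubset_refl _)).
rewrite (sg_mulw (fsubsetUl _ (msupp g2)) (fsubset_refl (msupp g))).
rewrite (sg_mulw (fsubsetUr (msupp g1) _) (fsubset_refl (msupp g))).
rewrite -big_split /=; apply: eq_bigr => h _.
rewrite -big_split /=; apply: eq_bigr => k _.
by rewrite mcoeffD amulDl sg_termD.
Qed.

Lemma sg_mulDr : right_distributive sg_mul +%R.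
Proof.
move=> g g1 g2; rewrite (sg_mulw (fsubset_refl _) (msuppD_le _ _)).
rewrite (sg_mulw (fsubset_refl (msupp g)) (fsubsetUl _ (msupp g2))).
rewrite (sg_mulw (fsubset_refl (msupp g)) (fsubsetUr (msupp g1) _)).
rewrite -big_split /=; apply: eq_bigr => h _.
rewrite -big_split /=; apply: eq_bigr => k _.
by rewrite mcoeffD amulDr sg_termD.
Qed.

Lemma sg_mul0l g : sg_mul 0 g = 0.
Proof. by rewrite /sg_mul msupp0 big_seq_fset0. Qed.

Lemma sg_mul0r g : sg_mul g 0 = 0.
Proof. by rewrite /sg_mul big1 // => h _; rewrite msupp0 big_seq_fset0. Qed.

Lemma sg_mul_suml I (r : seq I) (P : pred I) (F : I -> {malg A[K]}) g :
  sg_mul (\sum_(i <- r | P i) F i) g = \sum_(i <- r | P i) sg_mul (F i) g.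
Proof.
exact: (big_morph (sg_mul^~ g) (fun x y => sg_mulDl x y g) (sg_mul0l g)).
Qed.

Lemma sg_mul_sumr I (r : seq I) (P : pred I) (F : I -> {malg A[K]}) g :
  sg_mul g (\sum_(i <- r | P i) F i) = \sum_(i <- r | P i) sg_mul g (F i).
Proof. exact: (big_morph (sg_mul g) (sg_mulDr g) (sg_mul0r g)). Qed.

Lemma sg_mulUU a b h k : sg_mul << a *g h >> << b *g k >> = sg_term (a ** b) (op h k).
Proof. by rewrite (sg_mulw msuppU_le msuppU_le) !big_seq_fset1 !mcoeffUU. Qed.

Lemma sg_mulU_term a b h o : sg_mul << a *g h >> (sg_term b o) =
  sg_term (a ** b) (obind (op h) o).
Proof. by case: o => [k|] /=; rewrite ?sg_mulUU ?sg_mul0r. Qed.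

Lemma sg_mul_termU a b k o : sg_mul (sg_term a o) << b *g k >> =
  sg_term (a ** b) (obind (fun x => op x k) o).
Proof. by case: o => [h|] /=; rewrite ?sg_mulUU ?sg_mul0l. Qed.

Fact sg_mulA : associative sg_mul.
Proof.
move=> g1 g2 g3; rewrite [g1]monalgE !sg_mul_suml; apply: eq_bigr => h _.
rewrite [g2]monalgE !(sg_mul_suml, sg_mul_sumr); apply: eq_bigr => i _.
rewrite [g3]monalgE !sg_mul_sumr; apply: eq_bigr => k _.
by rewrite !sg_mulUU sg_mulU_term sg_mul_termU amulA ps_opA.
Qed.

Lemma msupp_sg_scale c g : msupp (sg_scale c g) `<=` msupp g.
Proof.
apply/fsubsetP => k; rewrite -!mcoeff_neq0 sg_scaleE.
by apply: contra_neq => ->; rewrite scaler0.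
Qed.

Fact sg_mulZl c (x y : T) : sg_mul (c *: x) y = c *: (sg_mul x y : T).
Proof.
rewrite (sg_mulw (msupp_sg_scale c x) (fsubset_refl _)) scaler_sumr.
apply: eq_bigr => h _; rewrite scaler_sumr; apply: eq_bigr => k _.
by rewrite sg_scaleE amulZl sg_termZ.
Qed.

Fact sg_mulZr c (x y : T) : sg_mul x (c *: y) = c *: (sg_mul x y : T).
Proof.
rewrite (sg_mulw (fsubset_refl _) (msupp_sg_scale c y)) scaler_sumr.
apply: eq_bigr => h _; rewrite scaler_sumr; apply: eq_bigr => k _.
by rewrite sg_scaleE amulZr sg_termZ.
Qed.

HB.instance Definition _ := Lmodule_isNuAlg.Build l T
  sg_mulA sg_mulDl sg_mulDr sg_mulZl sg_mulZr.

Fact sg_incl_linear k : linear (fun a => << a *g k >> : T).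
Proof.
move=> c a b; apply: etrans (monalgUD k (c *: a) b) _.
exact: (congr1 (+%R^~ << b *g k >>) (sg_termZ c a (Some k))).
Qed.

Definition sg_incl k (kk : op k k = Some k) : alg_hom A T.
Proof.
exists (fun a => << a *g k >> : T); first exact: sg_incl_linear.
by move=> a b; rewrite [RHS]sg_mulUU kk.
Defined.

End SemigroupAlgebra.

Section AddSemigroup.
Variable M : nmodType.

Fact add_sgA (h i k : M) :
  obind (fun x => Some (h + x)) (Some (i + k)) =
  obind (fun x => Some (x + k)) (Some (h + i)).
Proof. by rewrite /= addrA. Qed.

Definition add_sg : partial_semigroup M := PartialSemigroup add_sgA.

Fact add_sg0 : add_sg 0 0 = Some 0.
Proof. by rewrite /= addr0. Qed.

End AddSemigroup.

Section MatrixUnits.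

Definition mxunit_op (h k : nat * nat) : option (nat * nat) :=
  if h.2 == k.1 then Some (h.1, k.2) else None.

Fact mxunit_opA (h i k : nat * nat) :
  obind (mxunit_op h) (mxunit_op i k) =
  obind (fun x => mxunit_op x k) (mxunit_op h i).
Proof.
rewrite /mxunit_op; have [ik|ik] := eqVneq i.2 k.1.
  by rewrite /=; case: eqP => //= _; rewrite ik eqxx.
by case: eqP => //= _; rewrite (negbTE ik).
Qed.

Definition mxunit_sg : partial_semigroup (nat * nat)%type :=
  PartialSemigroup mxunit_opA.

End MatrixUnits.

Section PolyMatrix.
Variables (l : comPzRingType) (A : nuAlgType l).

Definition poly_alg : nuAlgType l := sgalg A (add_sg nat).

Definition poly_const : alg_hom A poly_alg :=
  @sg_incl l A nat (add_sg nat) 0 (add_sg0 nat).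

Definition mxN_alg : nuAlgType l := sgalg A mxunit_sg.

Definition mxN_corner : alg_hom A mxN_alg :=
  @sg_incl l A _ mxunit_sg (0%N, 0%N) erefl.

End PolyMatrix.

(* The multinomials library only covers non-zero coefficient rings. *)

Definition mvpoly (l : comPzRingType) (n : nat) : Type :=
  sgalg l^o (add_sg {ffun 'I_n -> nat}).

Section MvPoly.
Variables (l : comPzRingType) (n : nat).
Local Notation K := {ffun 'I_n -> nat}.
Local Notation P := (mvpoly l n).
Implicit Types (p q : P) (k : K).

HB.instance Definition _ := NuAlg.on P.

Let mul : P -> P -> P := fun p q => p ** q.

Lemma mv_mulUU (a b : l) (h k : K) :
  mul << a *g h >> << b *g k >> = << a * b *g h + k >>.
Proof. exact: (@sg_mulUU l l^o). Qed.

Let one : P := << (1 : l) *g (0 : K) >>.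

Fact mv_mulC : commutative mul.
Proof.
move=> p q; rewrite /mul [p](@monalgE K l) [q](@monalgE K l).
rewrite amul_suml amul_sumr; apply: eq_bigr => h _.
rewrite amul_suml amul_sumr; apply: eq_bigr => k _.
by rewrite -!/(mul _ _) !mv_mulUU mulrC addrC.
Qed.

Fact mv_mul1 : left_id one mul.
Proof.
move=> p; rewrite /mul [p](@monalgE K l) amul_sumr; apply: eq_bigr => h _.
by rewrite -/(mul _ _) mv_mulUU mul1r add0r.
Qed.

HB.instance Definition _ := GRing.Zmodule_isComPzRing.Build P
  (@amulA l P) mv_mulC mv_mul1 (@amulDl l P).

Definition mvC (c : l) : P := << c *g (0 : K) >>.

Definition mvX (i : 'I_n) : P := << (1 : l) *g ([ffun j => (j == i) : nat] : K) >>.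

Fact mvC_zmod : zmod_morphism mvC.
Proof. by move=> a b; exact: (monalgUB (0 : K)). Qed.

Fact mvC_monoid : monoid_morphism mvC.
Proof. by split=> // a b; rewrite -[RHS]/(mul _ _) mv_mulUU addr0. Qed.

HB.instance Definition _ := GRing.isZmodMorphism.Build l P mvC mvC_zmod.
HB.instance Definition _ := GRing.isMonoidMorphism.Build l P mvC mvC_monoid.

Lemma mvZE (c : l) (p : P) : c *: p = mvC c * p.
Proof.
rewrite -[p]mul1r -[c *: _](amulZl c (1 : P) p) mulrA mulr1; congr (_ ** _).
rewrite /mvC -[in RHS](mulr1 c).
exact: esym (sg_termZ (A := l^o) c 1 (Some (0 : K))).
Qed.

Lemma mvX_exp (i : 'I_n) m :
  mvX i ^+ m = << (1 : l) *g ([ffun j => ((j == i) * m)%N] : K) >>.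
Proof.
elim: m => [|m IHm].
  rewrite expr0 -[1]/one /one; congr (<< _ *g _ >>).
  by apply/ffunP => j; rewrite !ffunE muln0.
rewrite exprS IHm -[LHS]/(mul _ _) mv_mulUU mul1r; congr (<< _ *g _ >>).
by apply/ffunP => j; rewrite !ffunE mulnS.
Qed.

Lemma mv_monomial (c : l) k :
  << c *g k >> = mvC c * \prod_i mvX i ^+ k i :> P.
Proof.
have prodU (r : seq 'I_n) (F : 'I_n -> K) :
  \prod_(i <- r) (<< (1 : l) *g F i >> : P) = << (1 : l) *g \sum_(i <- r) F i >>.
  elim: r => [|i r IHr]; first by rewrite !big_nil.
  by rewrite !big_cons IHr -[LHS]/(mul _ _) mv_mulUU mul1r.
under eq_bigr do rewrite mvX_exp.
rewrite prodU -[RHS]/(mul _ _) mv_mulUU mulr1 add0r; congr (<< _ *g _ >>).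
apply/ffunP => j; rewrite sum_ffunE (bigD1 j) //= ffunE eqxx mul1n.
rewrite big1 ?addr0 // => i /negbTE; rewrite ffunE eq_sym => ->.
by rewrite mul0n.
Qed.

Section Eval.
Variables (S : comPzRingType) (f : {rmorphism l -> S}) (s : 'I_n -> S).

Definition mv_eval (p : P) : S :=
  \sum_(k <- msupp (p : {malg l[K]})) f (p : {malg l[K]})@_k * \prod_i s i ^+ k i.

Lemma mv_evalw (D : {fset K}) p : (msupp p `<=` D)%fset ->
  mv_eval p = \sum_(k <- D) f p@_k * \prod_i s i ^+ k i.
Proof.
move=> leD; rewrite /mv_eval (big_fset_incl _ leD) // => k _ /mcoeff_outdom ->.
by rewrite rmorph0 mul0r.
Qed.

Lemma mv_evalU (c : l) k : mv_eval << c *g k >> = f c * \prod_i s i ^+ k i.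
Proof. by rewrite (mv_evalw msuppU_le) big_seq_fset1 mcoeffUU. Qed.

Fact mv_eval_zmod : zmod_morphism mv_eval.
Proof.
move=> p q; rewrite (mv_evalw (msuppB_le p q)).
rewrite (mv_evalw (fsubsetUl _ (msupp q))) (mv_evalw (fsubsetUr (msupp p) _)).
rewrite -sumrB; apply: eq_bigr => k _.
by rewrite (@mcoeffB K l) rmorphB mulrBl.
Qed.

HB.instance Definition _ := GRing.isZmodMorphism.Build P S mv_eval mv_eval_zmod.

Fact mv_eval_monoid : monoid_morphism mv_eval.
Proof.
split.
  rewrite mv_evalU rmorph1 mul1r big1 // => i _.
  by rewrite ffunE expr0.
move=> p q; rewrite [p](@monalgE K l) [q](@monalgE K l).
rewrite mulr_suml !raddf_sum mulr_suml; apply: eq_bigr => h _.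
rewrite mulr_sumr !raddf_sum mulr_sumr; apply: eq_bigr => k _.
rewrite -[LHS]/(mv_eval (mul _ _)) -[RHS]/(mv_eval _ * mv_eval _).
rewrite mv_mulUU !mv_evalU rmorphM mulrACA.
congr (_ * _); rewrite -big_split; apply: eq_bigr => i _.
by rewrite ffunE exprD.
Qed.

HB.instance Definition _ := GRing.isMonoidMorphism.Build P S mv_eval mv_eval_monoid.

Lemma mv_evalC c : mv_eval (mvC c) = f c.
Proof.
by rewrite mv_evalU big1 ?mulr1 // => i _; rewrite ffunE expr0.
Qed.

Lemma mv_evalX i : mv_eval (mvX i) = s i.
Proof.
rewrite mv_evalU rmorph1 mul1r (bigD1 i) //= ffunE eqxx expr1.
by rewrite big1 ?mulr1 // => j /negbTE; rewrite ffunE => ->; rewrite expr0.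
Qed.

End Eval.

Lemma mv_ext (S : comPzRingType) (f g : {rmorphism P -> S}) :
  (forall c, f (mvC c) = g (mvC c)) -> (forall i, f (mvX i) = g (mvX i)) ->
  f =1 g.
Proof.
move=> fgC fgX p; rewrite [p](@monalgE K l) !raddf_sum.
apply: eq_bigr => k _.
rewrite -[LHS]/(f _) -[RHS]/(g _).
rewrite mv_monomial !rmorphM fgC; congr (_ * _).
by rewrite !rmorph_prod; apply: eq_bigr => i _; rewrite !rmorphXn fgX.
Qed.

End MvPoly.

Definition simp_op (m n : nat) :=
  {f : {ffun 'I_m.+1 -> 'I_n.+1} |
    [forall i : 'I_m.+1, forall j : 'I_m.+1, (i <= j)%N ==> (f i <= f j)%N]}.

Definition simp_fun m n (a : simp_op m n) : 'I_m.+1 -> 'I_n.+1 := val a.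
Coercion simp_fun : simp_op >-> Funclass.

Lemma simp_opP m n (a : simp_op m n) (i j : 'I_m.+1) :
  (i <= j)%N -> (a i <= a j)%N.
Proof. exact/implyP/(forallP (forallP (valP a) i)). Qed.

Lemma simp_op_ext m n (a b : simp_op m n) : a =1 b -> a = b.
Proof. by move=> ab; apply/val_inj/ffunP. Qed.

Definition simp_id n : simp_op n n.
Proof.
exists [ffun i => i]; apply/forallP => i; apply/forallP => j.
by rewrite !ffunE; apply/implyP.
Defined.

Definition simp_comp m n p (b : simp_op n p) (a : simp_op m n) : simp_op m p.
Proof.
exists [ffun i => b (a i)]; apply/forallP => i; apply/forallP => j.
by apply/implyP => ij; rewrite !ffunE; do 2!apply: simp_opP.
Defined.

Lemma simp_idE n i : simp_id n i = i.
Proof. by rewrite /simp_fun ffunE. Qed.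

Lemma simp_compE m n p (b : simp_op n p) (a : simp_op m n) i :
  simp_comp b a i = b (a i).
Proof. by rewrite {1}/simp_fun ffunE. Qed.

Record sset := SSet {
  simplex :> nat -> Type;
  sset_op : forall m n, simp_op m n -> simplex n -> simplex m;
  sset_op_id : forall n (x : simplex n), sset_op (simp_id n) x = x;
  sset_op_comp : forall m n p (b : simp_op n p) (a : simp_op m n) (x : simplex p),
    sset_op (simp_comp b a) x = sset_op a (sset_op b x)
}.
Arguments sset_op {s m n}.

Record sset_hom (X Y : sset) := SSetHom {
  sset_map :> forall n, X n -> Y n;
  sset_map_op : forall m n (a : simp_op m n) (x : X n),
    sset_map (sset_op a x) = sset_op a (sset_map x)
}.

Lemma sset_hom_ext X Y (f g : sset_hom X Y) : (forall n (x : X n), f n x = g n x) -> f = g.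
Proof.
case: f g => [f ff] [g gg] /= fg.
have efg : f = g by apply: functional_extensionality_dep => n; apply: funext.
by rewrite efg in ff *; congr SSetHom.
Qed.

Definition degenerate (X : sset) n (x : X n) : Prop :=
  exists m (a : simp_op n m) (y : X m),
    [/\ (m < n)%N, forall j, exists i, a i = j & x = sset_op a y].

Definition finite_sset (X : sset) : Prop :=
  finite_set [set x : {n & X n} | ~ degenerate (projT2 x)].

Record sset_action (gT : finGroupType) (X : sset) := SSetAction {
  sact :> gT -> sset_hom X X;
  sact1 : forall n (x : X n), sact 1%g n x = x;
  sactM : forall g h n (x : X n), sact (g * h)%g n x = sact g n (sact h n x)
}.

Definition free_action gT X (act : sset_action gT X) : Prop :=
  forall (g : gT) n (x : X n), g <> 1%g -> act g n x <> x.

Section Quotient.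
Variables (gT : finGroupType) (X : sset) (act : sset_action gT X).
Local Open Scope classical_set_scope.

Definition sorbit n (x : X n) : set (X n) := [set act g n x | g in [set: gT]].

Definition quot_simplex n : Type := {O : set (X n) | exists x, O = sorbit x}.

Lemma sorbit_op m n (a : simp_op m n) (x : X n) :
  [set sset_op a y | y in sorbit x] = sorbit (sset_op a x).
Proof.
apply/seteqP; split=> [_ [_ [g _ <-] <-]|_ [g _ <-]].
  by exists g; rewrite ?sset_map_op.
by exists (act g n x); [exists g | rewrite sset_map_op].
Qed.

Definition quot_op m n (a : simp_op m n) (O : quot_simplex n) : quot_simplex m.
Proof.
exists [set sset_op a y | y in sval O].
by have [x ->] := svalP O; exists (sset_op a x); exact: sorbit_op.
Defined.

Definition quot_sset : sset.
Proof.
exists quot_simplex quot_op.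
- move=> n [O HO]; apply: eq_exist => /=.
  by rewrite (_ : sset_op _ = id) ?image_id //; apply: funext => x; exact: sset_op_id.
- move=> m n p b a [O HO]; apply: eq_exist => /=.
  rewrite (_ : sset_op (simp_comp b a) = sset_op a \o sset_op b) ?image_comp //.
  by apply: funext => x; exact: sset_op_comp.
Defined.

End Quotient.

Section SimplexRing.
Variables (l : comPzRingType) (n : nat).
Local Notation P := (mvpoly l n.+1).

Definition simplex_eqn : P := \sum_i mvX l i - 1.

Definition simplex_ideal : {pred P} := fun p => `[< exists q, p = q * simplex_eqn >].

Lemma simplex_idealP p : reflect (exists q, p = q * simplex_eqn) (p \in simplex_ideal).
Proof. exact: asboolP. Qed.

Fact simplex_ideal_zmod : zmod_closed simplex_ideal.
Proof.
split=> [|_ _ /simplex_idealP[p ->] /simplex_idealP[q ->]].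
  by apply/simplex_idealP; exists 0; rewrite mul0r.
by apply/simplex_idealP; exists (p - q); rewrite mulrBl.
Qed.

HB.instance Definition _ := GRing.isZmodClosed.Build P simplex_ideal simplex_ideal_zmod.

Lemma simplex_idealM p q : q \in simplex_ideal -> p * q \in simplex_ideal.
Proof.
by case/simplex_idealP => r ->; apply/simplex_idealP; exists (p * r); rewrite mulrA.
Qed.

Definition simplex_ring : Type := Quotient.quot simplex_ideal.
Local Notation Q := simplex_ring.

HB.instance Definition _ := GRing.Zmodule.on Q.

Definition simplex_pi (p : P) : Q := \pi_(Quotient.quot simplex_ideal)%qT p.

Lemma simplex_piP p q : simplex_pi p = simplex_pi q <-> p - q \in simplex_ideal.
Proof. by rewrite Quotient.idealrBE; split=> [/eqP|/eqP]. Qed.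

Lemma simplex_pi_surj (x : Q) : exists p, x = simplex_pi p.
Proof. by exists (repr x); rewrite /simplex_pi reprK. Qed.

Let one : Q := simplex_pi 1.
Let mul (x y : Q) : Q := simplex_pi (repr x * repr y).
Let scale (c : l) (x : Q) : Q := simplex_pi (c *: repr x).

Lemma repr_simplex_pi p : repr (simplex_pi p) - p \in simplex_ideal.
Proof. by apply/simplex_piP; rewrite /simplex_pi reprK. Qed.

Fact simplex_pi_mul p q : mul (simplex_pi p) (simplex_pi q) = simplex_pi (p * q).
Proof.
apply/simplex_piP; set p' := repr _; set q' := repr _.
have -> : p' * q' - p * q = q' * (p' - p) + p * (q' - q).
  by rewrite !mulrBr addrA (mulrC q' p) subrK (mulrC q').
by rewrite rpredD // simplex_idealM // repr_simplex_pi.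
Qed.

Fact simplex_pi_scale c p : scale c (simplex_pi p) = simplex_pi (c *: p).
Proof.
apply/simplex_piP; rewrite -scalerBr mvZE.
by rewrite simplex_idealM // repr_simplex_pi.
Qed.

Fact simplex_pi_zmod : zmod_morphism simplex_pi.
Proof. by move=> p q; rewrite /simplex_pi !piE. Qed.

HB.instance Definition _ := GRing.isZmodMorphism.Build P Q simplex_pi simplex_pi_zmod.

Fact simplex_mulA : associative mul.
Proof.
move=> x y z; have [[[p ->] [q ->]] [r ->]] :=
  (simplex_pi_surj x, simplex_pi_surj y, simplex_pi_surj z).
by rewrite !simplex_pi_mul mulrA.
Qed.

Fact simplex_mulC : commutative mul.
Proof. by move=> x y; rewrite /mul mulrC. Qed.

Fact simplex_mul1 : left_id one mul.
Proof. by move=> x; have [p ->] := simplex_pi_surj x; rewrite simplex_pi_mul mul1r. Qed.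

Fact simplex_mulDl : left_distributive mul +%R.
Proof.
move=> x y z; have [[[p ->] [q ->]] [r ->]] :=
  (simplex_pi_surj x, simplex_pi_surj y, simplex_pi_surj z).
by rewrite -raddfD !simplex_pi_mul mulrDl raddfD.
Qed.

HB.instance Definition _ := GRing.Zmodule_isComPzRing.Build Q
  simplex_mulA simplex_mulC simplex_mul1 simplex_mulDl.

Fact simplex_pi_monoid : monoid_morphism simplex_pi.
Proof. by split=> // p q; rewrite -simplex_pi_mul. Qed.

HB.instance Definition _ := GRing.isMonoidMorphism.Build P Q simplex_pi simplex_pi_monoid.

Fact simplex_scaleA c d x : scale c (scale d x) = scale (c * d) x.
Proof.
by have [p ->] := simplex_pi_surj x; rewrite !simplex_pi_scale scalerA.
Qed.

Fact simplex_scale1 : left_id 1 scale.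
Proof.
by move=> x; have [p ->] := simplex_pi_surj x; rewrite simplex_pi_scale scale1r.
Qed.

Fact simplex_scaleDr : right_distributive scale +%R.
Proof.
move=> c x y; have [[p ->] [q ->]] := (simplex_pi_surj x, simplex_pi_surj y).
by rewrite -raddfD !simplex_pi_scale scalerDr raddfD.
Qed.

Fact simplex_scaleDl x : {morph scale^~ x : c d / c + d}.
Proof.
move=> c d; have [p ->] := simplex_pi_surj x.
by rewrite !simplex_pi_scale scalerDl raddfD.
Qed.

HB.instance Definition _ := GRing.Zmodule_isLmodule.Build l Q
  simplex_scaleA simplex_scale1 simplex_scaleDr simplex_scaleDl.

Lemma simplex_piZ c p : simplex_pi (c *: p) = c *: simplex_pi p.
Proof. by rewrite -simplex_pi_scale. Qed.

Fact simplex_mulZl (c : l) (x y : Q) : (c *: x) * y = c *: (x * y).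
Proof.
have [[p ->] [q ->]] := (simplex_pi_surj x, simplex_pi_surj y).
by rewrite -simplex_piZ -!rmorphM -simplex_piZ /= !mvZE mulrA.
Qed.

Fact simplex_mulZr (c : l) (x y : Q) : x * (c *: y) = c *: (x * y).
Proof. by rewrite mulrC simplex_mulZl mulrC. Qed.

HB.instance Definition _ := Lmodule_isNuAlg.Build l Q
  (@mulrA Q) (@mulrDl Q) (@mulrDr Q) simplex_mulZl simplex_mulZr.

End SimplexRing.

Section SimplexMap.
Variable l : comPzRingType.

Definition simplex_subst m n (a : simp_op m n) : mvpoly l n.+1 -> mvpoly l m.+1 :=
  mv_eval (@mvC l m.+1) (fun i => \sum_(j | a j == i) mvX l j).

Definition simplex_map m n (a : simp_op m n) (x : simplex_ring l n) :
  simplex_ring l m := simplex_pi (simplex_subst a (repr x)).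

Lemma simplex_subst_eqn m n (a : simp_op m n) :
  simplex_subst a (simplex_eqn l n) = simplex_eqn l m.
Proof.
rewrite /simplex_subst rmorphB rmorph1 rmorph_sum; congr (_ - _).
under eq_bigr do rewrite /= mv_evalX.
by rewrite [RHS](partition_big (fun j => a j) predT).
Qed.

Lemma simplex_mapE m n (a : simp_op m n) p :
  simplex_map a (simplex_pi p) = simplex_pi (simplex_subst a p).
Proof.
apply/simplex_piP; rewrite /simplex_subst -rmorphB.
have /simplex_idealP[q ->] := repr_simplex_pi p.
rewrite rmorphM; apply: simplex_idealM; apply/simplex_idealP; exists 1.
by rewrite mul1r -(simplex_subst_eqn a).
Qed.

Fact simplex_map_linear m n (a : simp_op m n) : linear (simplex_map a).
Proof.
move=> c x y; have [[p ->] [q ->]] := (simplex_pi_surj x, simplex_pi_surj y).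
rewrite -simplex_piZ -raddfD !simplex_mapE /simplex_subst rmorphD.
by rewrite raddfD -simplex_piZ /= !mvZE rmorphM /= mv_evalC.
Qed.

Fact simplex_mapM m n (a : simp_op m n) : {morph simplex_map a : x y / x ** y}.
Proof.
move=> x y; have [[p ->] [q ->]] := (simplex_pi_surj x, simplex_pi_surj y).
rewrite -[LHS]/(simplex_map a (_ * _)) -[RHS]/(_ * _).
by rewrite -rmorphM !simplex_mapE /simplex_subst -!rmorphM.
Qed.

Definition simplex_hom m n (a : simp_op m n) :
  alg_hom (simplex_ring l n) (simplex_ring l m) :=
  AlgHom (simplex_map_linear a) (@simplex_mapM m n a).

Fact simplex_map_id n (x : simplex_ring l n) : simplex_map (simp_id n) x = x.
Proof.
have [p ->] := simplex_pi_surj x; rewrite simplex_mapE; congr simplex_pi.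
apply: (@mv_ext l n.+1 _ (mv_eval _ _) idfun) => [c|i] /=.
  by rewrite mv_evalC.
by rewrite mv_evalX (big_pred1 i) // => j; rewrite simp_idE.
Qed.

Fact simplex_map_comp m n p (b : simp_op n p) (a : simp_op m n)
  (x : simplex_ring l p) :
  simplex_map (simp_comp b a) x = simplex_map a (simplex_map b x).
Proof.
have [q ->] := simplex_pi_surj x; rewrite !simplex_mapE; congr simplex_pi.
apply: (@mv_ext l p.+1 _ (mv_eval _ _) (mv_eval _ _ \o mv_eval _ _)) => [c|i] /=.
  by rewrite !mv_evalC.
rewrite !mv_evalX rmorph_sum /=.
under [RHS]eq_bigr do rewrite mv_evalX.
rewrite (partition_big (fun j => a j) (fun k => b k == i)) /=; last first.
  by move=> j; rewrite simp_compE.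
apply: eq_bigr => k bk; apply: eq_bigl => j; rewrite simp_compE.
by case: (a j =P k) => [->|]; rewrite ?bk ?andbF.
Qed.

Definition simplex_sset : sset := SSet simplex_map_id simplex_map_comp.

End SimplexMap.

Definition pwpoly (l : comPzRingType) (X : sset) : Type :=
  sset_hom X (simplex_sset l).

Section PwPoly.
Variables (l : comPzRingType) (X : sset).
Local Notation T := (pwpoly l X).
Implicit Types (f g h : T) (c : l).

HB.instance Definition _ := gen_eqMixin T.
HB.instance Definition _ := gen_choiceMixin T.

Let val f n (x : X n) : simplex_ring l n := f n x.

Definition pw_val f n (x : X n) : simplex_ring l n := f n x.

Lemma pw_val_op f m n (a : simp_op m n) (x : X n) :
  pw_val f (sset_op a x) = simplex_hom l a (pw_val f x).
Proof. exact: (sset_map_op f a x). Qed.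

Lemma pw_ext f g : (forall n (x : X n), pw_val f x = pw_val g x) -> f = g.
Proof. exact: (@sset_hom_ext X (simplex_sset l) f g). Qed.

Definition pw_zero : T.
Proof.
exists (fun n x => 0 : simplex_ring l n) => m n a x.
by apply: esym; exact: (alg_hom0 (simplex_hom l a)).
Defined.

Definition pw_opp f : T.
Proof.
exists (fun n x => - pw_val f x) => m n a x.
rewrite pw_val_op; apply: esym; exact: (alg_homN (simplex_hom l a)).
Defined.

Definition pw_add f g : T.
Proof.
exists (fun n x => pw_val f x + pw_val g x) => m n a x.
rewrite !pw_val_op; apply: esym; exact: (alg_homD (simplex_hom l a)).
Defined.

Definition pw_scale c f : T.
Proof.
exists (fun n x => c *: pw_val f x) => m n a x.
rewrite pw_val_op; apply: esym; exact: (alg_homZ (simplex_hom l a)).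
Defined.

Definition pw_mul f g : T.
Proof.
exists (fun n x => pw_val f x ** pw_val g x) => m n a x.
rewrite !pw_val_op; apply: esym; exact: (alg_homM (simplex_hom l a)).
Defined.

Fact pw_addA : associative pw_add.
Proof. by move=> f g h; apply: pw_ext => n x; exact: addrA. Qed.

Fact pw_addC : commutative pw_add.
Proof. by move=> f g; apply: pw_ext => n x; exact: addrC. Qed.

Fact pw_add0 : left_id pw_zero pw_add.
Proof. by move=> f; apply: pw_ext => n x; exact: add0r. Qed.

Fact pw_addN : left_inverse pw_zero pw_opp pw_add.
Proof. by move=> f; apply: pw_ext => n x; exact: addNr. Qed.

HB.instance Definition _ := GRing.isZmodule.Build T
  pw_addA pw_addC pw_add0 pw_addN.

Fact pw_scaleA c d f : pw_scale c (pw_scale d f) = pw_scale (c * d) f.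
Proof. by apply: pw_ext => n x; exact: scalerA. Qed.

Fact pw_scale1 : left_id 1 pw_scale.
Proof. by move=> f; apply: pw_ext => n x; exact: scale1r. Qed.

Fact pw_scaleDr : right_distributive pw_scale +%R.
Proof. by move=> c f g; apply: pw_ext => n x; exact: scalerDr. Qed.

Fact pw_scaleDl f : {morph pw_scale^~ f : c d / c + d}.
Proof. by move=> c d; apply: pw_ext => n x; exact: scalerDl. Qed.

HB.instance Definition _ := GRing.Zmodule_isLmodule.Build l T
  pw_scaleA pw_scale1 pw_scaleDr pw_scaleDl.

Fact pw_mulA : associative pw_mul.
Proof. by move=> f g h; apply: pw_ext => n x; exact: amulA. Qed.

Fact pw_mulDl : left_distributive pw_mul +%R.
Proof. by move=> f g h; apply: pw_ext => n x; exact: amulDl. Qed.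

Fact pw_mulDr : right_distributive pw_mul +%R.
Proof. by move=> f g h; apply: pw_ext => n x; exact: amulDr. Qed.

Fact pw_mulZl c f g : pw_mul (c *: f) g = c *: pw_mul f g.
Proof. by apply: pw_ext => n x; exact: amulZl. Qed.

Fact pw_mulZr c f g : pw_mul f (c *: g) = c *: pw_mul f g.
Proof. by apply: pw_ext => n x; exact: amulZr. Qed.

HB.instance Definition _ := Lmodule_isNuAlg.Build l T
  pw_mulA pw_mulDl pw_mulDr pw_mulZl pw_mulZr.

End PwPoly.

Record galgebra (l : comPzRingType) (gT : finGroupType) := GAlgebra {
  galg :> nuAlgType l;
  galg_act : gT -> alg_hom galg galg;
  galg_act1 : forall a, galg_act 1%g a = a;
  galg_actM : forall g h a, galg_act (g * h)%g a = galg_act g (galg_act h a)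
}.

Section PwPolyAction.
Variables (l : comPzRingType) (gT : finGroupType) (X : sset).
Variable act : sset_action gT X.

Definition pw_act_fun (g : gT) (f : pwpoly l X) : pwpoly l X.
Proof.
exists (fun n x => f n (act g^-1%g n x)) => m n a x.
by rewrite !sset_map_op.
Defined.

Definition pw_act (g : gT) : alg_hom (pwpoly l X) (pwpoly l X).
Proof.
by exists (pw_act_fun g) => [c f h|f h]; apply: pw_ext.
Defined.

Definition pwpoly_galg : galgebra l gT.
Proof.
exists (pwpoly l X) pw_act => [f|g h f]; apply: pw_ext => n x.
- by rewrite /pw_val /= invg1 sact1.
- by rewrite /pw_val /= invMg sactM.
Defined.

End PwPolyAction.

(* As G is finite, A (x) l[G] is the module of all functions G -> A: the sum of
   the a_g (x) g is the function g |-> a_g. *)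
Definition crossed (l : comPzRingType) (gT : finGroupType) (A : galgebra l gT) :
  Type := {ffun gT -> A}.

Section Crossed.
Variables (l : comPzRingType) (gT : finGroupType) (A : galgebra l gT).
Local Notation T := (crossed A).
Implicit Types (u v w : T) (g h k : gT) (a b : A) (c : l).

HB.instance Definition _ := GRing.Lmodule.on T.

Definition crossed_mul u v : T :=
  [ffun k => \sum_h u h ** galg_act A h (v (h^-1 * k)%g)].

Fact crossed_mulA : associative crossed_mul.
Proof.
move=> u v w; apply/ffunP => k; rewrite !ffunE.
transitivity (\sum_g \sum_h (u g ** galg_act A g (v h)) **
  galg_act A (g * h)%g (w (h^-1 * (g^-1 * k))%g)).
  apply: eq_bigr => g _; rewrite ffunE alg_hom_sum amul_sumr.
  by apply: eq_bigr => h _; rewrite alg_homM amulA galg_actM.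
under [RHS]eq_bigr do rewrite ffunE amul_suml.
rewrite [RHS]exchange_big; apply: eq_bigr => g _ /=.
rewrite [RHS](reindex (fun h => (g * h)%g)) /=; last first.
  by exists (fun h => (g^-1 * h)%g) => h _; rewrite ?mulKg ?mulKVg.
by apply: eq_bigr => h _; rewrite mulKg invMg mulgA.
Qed.

Fact crossed_mulDl : left_distributive crossed_mul +%R.
Proof.
move=> u v w; apply/ffunP => k; rewrite !ffunE -big_split.
by apply: eq_bigr => h _; rewrite ffunE amulDl.
Qed.

Fact crossed_mulDr : right_distributive crossed_mul +%R.
Proof.
move=> u v w; apply/ffunP => k; rewrite !ffunE -big_split.
by apply: eq_bigr => h _; rewrite ffunE alg_homD amulDr.
Qed.

Fact crossed_mulZl c u v : crossed_mul (c *: u) v = c *: crossed_mul u v.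
Proof.
apply/ffunP => k; rewrite !ffunE scaler_sumr.
by apply: eq_bigr => h _; rewrite ffunE amulZl.
Qed.

Fact crossed_mulZr c u v : crossed_mul u (c *: v) = c *: crossed_mul u v.
Proof.
apply/ffunP => k; rewrite !ffunE scaler_sumr.
by apply: eq_bigr => h _; rewrite ffunE alg_homZ amulZr.
Qed.

HB.instance Definition _ := Lmodule_isNuAlg.Build l T
  crossed_mulA crossed_mulDl crossed_mulDr crossed_mulZl crossed_mulZr.

Definition crossed_elt a g : T := [ffun h => if h == g then a else 0].

Lemma crossed_eltM a b g h :
  crossed_elt a g ** crossed_elt b h = crossed_elt (a ** galg_act A g b) (g * h)%g.
Proof.
apply/ffunP => k; rewrite !ffunE (bigD1 g) //= big1 => [|i /negbTE gi].
  rewrite !ffunE eqxx addr0 (can2_eq (mulKVg g) (mulKg g)).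
  by case: eqP; rewrite ?alg_hom0 ?amul0r.
by rewrite !ffunE gi amul0l.
Qed.

End Crossed.

Record category := Category {
  obj :> Type;
  hom : obj -> obj -> Type;
  idm : forall A, hom A A;
  compm : forall A B C, hom B C -> hom A B -> hom A C;
  compmA : forall A B C D (h : hom C D) (g : hom B C) (f : hom A B),
    compm h (compm g f) = compm (compm h g) f;
  comp1m : forall A B (f : hom A B), compm (idm B) f = f;
  compm1 : forall A B (f : hom A B), compm f (idm A) = f
}.
Arguments hom {c} A B.
Arguments idm {c} A.
Arguments compm {c A B C} g f.

Notation "g \oc f" := (compm g f) (at level 40, left associativity).

Definition is_iso (C : category) (A B : C) (f : hom A B) : Prop :=
  exists g : hom B A, g \oc f = idm A /\ f \oc g = idm B.

Definition isomorphic (C : category) (A B : C) : Prop :=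
  exists f : hom A B, is_iso f.

Record functor (C D : category) := Functor {
  fobj :> C -> D;
  fmap : forall A B, hom A B -> hom (fobj A) (fobj B);
  fmap_id : forall A, fmap (idm A) = idm (fobj A);
  fmap_comp : forall A B E (g : hom B E) (f : hom A B),
    fmap (g \oc f) = fmap g \oc fmap f
}.
Arguments fmap {C D} f0 {A B} f.

Definition functor_id (C : category) : functor C C.
Proof. by exists id (fun _ _ f => f). Defined.

Definition functor_comp (C D E : category) (G : functor D E) (F : functor C D) :
  functor C E.
Proof.
exists (fun A => G (F A)) (fun _ _ f => fmap G (fmap F f)) => [A|A B X g f].
- by rewrite !fmap_id.
- by rewrite !fmap_comp.
Defined.

Record nat_iso (C D : category) (F G : functor C D) := NatIso {
  niso :> forall A, hom (F A) (G A);
  niso_inv : forall A, hom (G A) (F A);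
  niso_nat : forall A B (f : hom A B), niso B \oc fmap F f = fmap G f \oc niso A;
  niso_invl : forall A, niso_inv A \oc niso A = idm (F A);
  niso_invr : forall A, niso A \oc niso_inv A = idm (G A)
}.
Arguments niso_inv {C D F G} n A.

Definition is_equivalence (C D : category) (F : functor C D) : Prop :=
  exists G : functor D C,
    inhabited (nat_iso (functor_comp G F) (functor_id C)) /\
    inhabited (nat_iso (functor_comp F G) (functor_id D)).

Record preadditive := Preadditive {
  padd_cat :> category;
  padd_zmod : forall A B : padd_cat, GRing.Zmodule (hom A B);
  padd_compDl : forall (A B C : padd_cat)
    (g g' : GRing.Zmodule.Pack (padd_zmod B C)) (f : hom A B),
    (g + g') \oc f = (g \oc f : GRing.Zmodule.Pack (padd_zmod A C)) + (g' \oc f);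
  padd_compDr : forall (A B C : padd_cat) (g : hom B C)
    (f f' : GRing.Zmodule.Pack (padd_zmod A B)),
    g \oc (f + f') = (g \oc f : GRing.Zmodule.Pack (padd_zmod A C)) + (g \oc f')
}.

HB.instance Definition _ (C : preadditive) (A B : C) :=
  GRing.Zmodule.copy (hom A B) (GRing.Zmodule.Pack (padd_zmod A B)).

Definition additive_functor (C D : preadditive) (F : functor C D) : Prop :=
  forall (A B : C) (f g : hom A B),
    fmap F (f + g) = fmap F f + fmap F g.

Definition is_zero_obj (C : preadditive) (Z : C) : Prop :=
  forall A : C, (forall f : hom A Z, f = 0) /\ (forall f : hom Z A, f = 0).

Definition is_biproduct (C : preadditive) (A B P : C) : Prop :=
  exists (i1 : hom A P) (i2 : hom B P) (p1 : hom P A) (p2 : hom P B),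
    [/\ p1 \oc i1 = idm A, p2 \oc i2 = idm B,
        p2 \oc i1 = 0 :> hom A B, p1 \oc i2 = 0 :> hom B A
      & i1 \oc p1 + i2 \oc p2 = idm P].

Definition is_additive (C : preadditive) : Prop :=
  (exists Z : C, is_zero_obj Z) /\
  (forall A B : C, exists P, is_biproduct A B P).

(* Triangulated categories, in terms of the desuspension Om: the triangles are
   written Om C --h--> A --f--> B --g--> C.  These are the usual axioms for the
   opposite category with suspension Om. *)
Record triangulated := Triangulated {
  tri_cat :> preadditive;
  tri_additive : is_additive tri_cat;
  loop : functor tri_cat tri_cat;
  loop_additive : additive_functor loop;
  loop_equiv : is_equivalence loop;
  dist : forall A B C : tri_cat,
    hom (loop C) A -> hom A B -> hom B C -> Prop;
  dist_iso : forall (A B C A' B' C' : tri_cat)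
      (h : hom (loop C) A) (f : hom A B) (g : hom B C)
      (h' : hom (loop C') A') (f' : hom A' B') (g' : hom B' C')
      (a : hom A A') (b : hom B B') (c : hom C C'),
    is_iso a -> is_iso b -> is_iso c ->
    a \oc h = h' \oc fmap loop c -> b \oc f = f' \oc a -> c \oc g = g' \oc b ->
    dist h f g -> dist h' f' g';
  dist_id : forall A Z : tri_cat, is_zero_obj Z ->
    dist (0 : hom (loop Z) A) (idm A) (0 : hom A Z);
  dist_ex : forall (B C : tri_cat) (g : hom B C),
    exists (A : tri_cat) (h : hom (loop C) A) (f : hom A B), dist h f g;
  dist_rot : forall (A B C : tri_cat)
      (h : hom (loop C) A) (f : hom A B) (g : hom B C),
    dist h f g <-> dist (- fmap loop g) h f;
  dist_fill : forall (A B C A' B' C' : tri_cat)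
      (h : hom (loop C) A) (f : hom A B) (g : hom B C)
      (h' : hom (loop C') A') (f' : hom A' B') (g' : hom B' C')
      (b : hom B B') (c : hom C C'),
    dist h f g -> dist h' f' g' -> c \oc g = g' \oc b ->
    exists a : hom A A', b \oc f = f' \oc a /\ a \oc h = h' \oc fmap loop c;
  (* the octahedral axiom: for B --g1--> C --g2--> D, with "fibres" F1 of g1,
     F2 of g2 and F3 of g2 g1 *)
  dist_oct : forall (B C D F1 F2 F3 : tri_cat)
      (g1 : hom B C) (g2 : hom C D)
      (h1 : hom (loop C) F1) (f1 : hom F1 B)
      (h2 : hom (loop D) F2) (f2 : hom F2 C)
      (h3 : hom (loop D) F3) (f3 : hom F3 B),
    dist h1 f1 g1 -> dist h2 f2 g2 -> dist h3 f3 (g2 \oc g1) ->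
    exists (a : hom F1 F3) (b : hom F3 F2),
      [/\ dist (h1 \oc fmap loop f2) a b,
          f3 \oc a = f1, f2 \oc b = g1 \oc f3,
          a \oc h1 = h3 \oc fmap loop g2 & b \oc h3 = h2]
}.
Arguments loop {t}.
Arguments dist {t A B C}.

Record triangulated_functor (T T' : triangulated) := TriangulatedFunctor {
  tfun :> functor T T';
  tfun_additive : additive_functor tfun;
  tfun_loop : nat_iso (functor_comp tfun loop) (functor_comp loop tfun);
  tfun_dist : forall (A B C : T)
      (h : hom (loop C) A) (f : hom A B) (g : hom B C),
    dist h f g ->
    dist (fmap tfun h \oc niso_inv tfun_loop C) (fmap tfun f) (fmap tfun g)
}.
Arguments tfun_loop {T T'} t.

Definition Alg (l : comPzRingType) : category.
Proof.
by exists (nuAlgType l) (@alg_hom l) (@alg_id l) (@alg_comp l) => *;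
   apply: alg_hom_ext.
Defined.

Record extension (l : comPzRingType) := Extension {
  ext_ker : Alg l;
  ext_mid : Alg l;
  ext_quo : Alg l;
  ext_inj : alg_hom ext_ker ext_mid;
  ext_surj : alg_hom ext_mid ext_quo;
  ext_inj_inj : injective ext_inj;
  ext_exact : forall b : ext_mid, ext_surj b = 0 <-> exists a, ext_inj a = b;
  ext_split : exists s : {linear ext_quo -> ext_mid}, forall c, ext_surj (s c) = c
}.

Record extension_hom (l : comPzRingType) (E E' : extension l) := ExtensionHom {
  exth_ker : alg_hom (ext_ker E) (ext_ker E');
  exth_mid : alg_hom (ext_mid E) (ext_mid E');
  exth_quo : alg_hom (ext_quo E) (ext_quo E');
  exth_inj : forall a, exth_mid (ext_inj E a) = ext_inj E' (exth_ker a);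
  exth_surj : forall b, exth_quo (ext_surj E b) = ext_surj E' (exth_mid b)
}.

Definition homotopy_invariant l (D : category) (Y : functor (Alg l) D) : Prop :=
  forall A : Alg l, is_iso (fmap Y (poly_const A : hom A (poly_alg A : Alg l))).

Definition matrix_stable l (D : category) (Y : functor (Alg l) D) : Prop :=
  forall A : Alg l, is_iso (fmap Y (mxN_corner A : hom A (mxN_alg A : Alg l))).

Record excisive_functor (l : comPzRingType) (T : triangulated) :=
ExcisiveFunctor {
  exc_fun :> functor (Alg l) T;
  boundary : forall E : extension l,
    hom (loop (exc_fun (ext_quo E))) (exc_fun (ext_ker E));
  boundary_nat : forall (E E' : extension l) (e : extension_hom E E'),
    fmap exc_fun (exth_ker e : hom (ext_ker E) (ext_ker E')) \oc boundary E =
    boundary E' \oc fmap loop (fmap exc_fun (exth_quo e : hom (ext_quo E) (ext_quo E')));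
  boundary_dist : forall E : extension l,
    dist (boundary E) (fmap exc_fun (ext_inj E : hom (ext_ker E) (ext_mid E)))
                      (fmap exc_fun (ext_surj E : hom (ext_mid E) (ext_quo E)))
}.
Arguments boundary {l T} Y E : rename.

Section Universal.
Variables (l : comPzRingType) (T : triangulated) (j : excisive_functor l T).

Record factorization (T' : triangulated) (Y : excisive_functor l T') :=
Factorization {
  fact_fun :> triangulated_functor T T';
  fact_iso : nat_iso (functor_comp fact_fun j) Y;
  fact_boundary : forall E : extension l,
    boundary Y E \oc fmap loop (fact_iso (ext_quo E)) =
    fact_iso (ext_ker E) \oc
      (fmap fact_fun (boundary j E) \oc niso_inv (tfun_loop fact_fun) (j (ext_quo E)))
}.

Record factorization_iso (T' : triangulated) (Y : excisive_functor l T')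
  (F F' : factorization Y) := FactorizationIso {
  facti :> nat_iso F F';
  facti_loop : forall A : T,
    fmap loop (facti A) \oc tfun_loop F A = tfun_loop F' A \oc facti (loop A);
  facti_iso : forall A : Alg l, fact_iso F' A \oc facti (j A) = fact_iso F A
}.

(* Existence and uniqueness of the factorization are taken in the sense
   appropriate to functors: F o j is isomorphic to Y, compatibly with the
   boundary maps, and two such factorizations are related by a unique
   isomorphism.  A strictly initial j satisfies this. *)
Definition is_kk : Prop :=
  [/\ homotopy_invariant j, matrix_stable j &
      forall (T' : triangulated) (Y : excisive_functor l T'),
        homotopy_invariant Y -> matrix_stable Y ->
        inhabited (factorization Y) /\
        forall F F' : factorization Y, exists! theta : factorization_iso F F', True].

Definition kk_equivalent (A B : Alg l) : Prop := isomorphic (j A) (j B).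

End Universal.

(* Main.v *)
Require Import Defs.
From HB Require Import structures.
From mathcomp Require Import all_boot all_order all_fingroup all_algebra.
From mathcomp Require Import finmap.
From mathcomp.multinomials Require Import monalg.
From mathcomp Require Import boolp classical_sets cardinality.

(** l^X is a Galois extension of l^(X/G), so that l^X x| G and l^(X/G) are
    Morita equivalent; only the matrix stability of j is needed.

    Since G acts freely, there is an equivariant map c from the vertices of X to
    G.  For a word w over G without equal consecutive letters, let f_w in l^X be
    given on a simplex with barycentric coordinates t_0, ..., t_n by the sum of
    the products t_(i_0) ... t_(i_k), over i_0 < ... < i_k such that the vertices
    i_0, ..., i_k have labels w.  Thus f_w is the coefficient of w in the
    holonomy (1 + t_0 x_(c 0)) ... (1 + t_n x_(c n)), in noncommuting variables
    of square zero.  One has g f_w = f_(gw), the f_w of one-letter words add up to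
    1, and f_w = 0 when w is longer than dim X + 1.  The inverse of the holonomy
    has coefficients (-1)^|w| f_(rev w), so that f_w f_v is in the ideal generated
    by the f_u with |u| > |w| whenever |w| = |v| and w, v have distinct first
    letters.  By induction on k, the functions G -> l^X are spanned by the
    g |-> a g(b) and by those with values in the ideal of the f_u with |u| >= k.
    For k large, this expresses the indicator function of 1 as the sum of some
    g |-> x_j g(y_j), and f_(1) has trace 1: these are Galois data. *)

Set Implicit Arguments.
Unset Strict Implicit.
Unset Printing Implicit Defensive.

Import Defs GRing.Theory.

Local Open Scope ring_scope.
Local Open Scope nualg_scope.

(** * Matrix-stable functors *)

Section SemigroupLift.
Variables (l : comPzRingType) (A B : nuAlgType l) (K : choiceType).
Variable op : partial_semigroup K.
Variable h : K -> A -> B.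
Hypothesis h_linear : forall k, linear (h k).
Hypothesis hM : forall k k' a b,
  h k a ** h k' b = if op k k' is Some m then h m (a ** b) else 0.

HB.instance Definition _ k := GRing.isLinear.Build l A B *:%R (h k) (h_linear k).

Definition sg_lift_fun (g : sgalg A op) : B :=
  \sum_(k <- msupp (g : {malg A[K]})) h k (g : {malg A[K]})@_k.

Lemma sg_lift_funw (D : {fset K}) (g : {malg A[K]}) : (msupp g `<=` D)%fset ->
  sg_lift_fun g = \sum_(k <- D) h k g@_k.
Proof.
move=> leD; rewrite /sg_lift_fun (big_fset_incl _ leD) // => k _.
by move=> /mcoeff_outdom ->; rewrite raddf0.
Qed.

Lemma sg_lift_funU a k : sg_lift_fun << a *g k >> = h k a.
Proof. by rewrite (sg_lift_funw msuppU_le) big_seq_fset1 mcoeffUU. Qed.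

Fact sg_lift_linear : linear sg_lift_fun.
Proof.
move=> c x y.
rewrite (sg_lift_funw (D := (msupp (x : {malg A[K]}) `|` msupp (y : {malg A[K]}))%fset)).
  rewrite (sg_lift_funw (fsubsetUl _ (msupp (y : {malg A[K]})))).
  rewrite (sg_lift_funw (fsubsetUr (msupp (x : {malg A[K]})) _)).
  rewrite scaler_sumr -big_split; apply: eq_bigr => k _ /=.
  rewrite -[X in h k X]/((sg_scale c (x : {malg A[K]}) + (y : {malg A[K]}))@_k).
  by rewrite mcoeffD sg_scaleE linearP.
apply: fsubset_trans (msuppD_le _ _) _; apply: fsetSU.
exact: msupp_sg_scale.
Qed.

HB.instance Definition _ :=
  GRing.isLinear.Build l (sgalg A op) B *:%R sg_lift_fun sg_lift_linear.

Fact sg_liftM : {morph sg_lift_fun : x y / x ** y}.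
Proof.
move=> x y; rewrite [x](@monalgE K A) [y](@monalgE K A).
rewrite amul_suml !raddf_sum amul_suml; apply: eq_bigr => k _.
rewrite amul_sumr !raddf_sum amul_sumr; apply: eq_bigr => k' _.
rewrite -[LHS]/(sg_lift_fun (sg_mul op _ _)) -[RHS]/(sg_lift_fun _ ** sg_lift_fun _).
rewrite sg_mulUU !sg_lift_funU hM; case: (op k k') => [m|] /=.
  exact: sg_lift_funU.
exact: raddf0.
Qed.

(** The universal property of the contracted semigroup algebra. *)
Definition sg_lift : alg_hom (sgalg A op) B := AlgHom sg_lift_linear sg_liftM.

Lemma sg_liftU a k : sg_lift << a *g k >> = h k a.
Proof. exact: sg_lift_funU. Qed.

End SemigroupLift.

Lemma sgalg_hom_ext (l : comPzRingType) (A B : nuAlgType l) (K : choiceType)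
    (op : partial_semigroup K) (f g : alg_hom (sgalg A op) B) :
  (forall a k, f << a *g k >> = g << a *g k >>) -> f = g.
Proof.
move=> fg; apply: alg_hom_ext => x.
by rewrite [x](@monalgE K A) !alg_hom_sum; apply: eq_bigr => k _.
Qed.

Section MatrixTerm.
Variables (l : comPzRingType) (A : nuAlgType l).

Definition mxterm (i j : nat) (a : A) : mxN_alg A := << a *g (i, j) >>.

Fact mxterm_linear i j : linear (mxterm i j).
Proof. exact: (@sg_incl_linear l A _ mxunit_sg). Qed.

HB.instance Definition _ i j :=
  GRing.isLinear.Build l A (mxN_alg A) *:%R (mxterm i j) (mxterm_linear i j).

Lemma mxtermM i j i' j' a b :
  mxterm i j a ** mxterm i' j' b = if j == i' then mxterm i j' (a ** b) else 0.
Proof.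
rewrite [LHS](@sg_mulUU l A _ mxunit_sg) /= /mxunit_op /=.
by case: eqP.
Qed.

Definition mxN_incl (i : nat) : alg_hom A (mxN_alg A).
Proof.
exists (mxterm i i); first exact: mxterm_linear.
by move=> a b; rewrite mxtermM eqxx.
Defined.

End MatrixTerm.

Section MatrixLift.
Variables (l : comPzRingType) (A B : nuAlgType l).
Variable h : nat -> nat -> A -> B.
Hypothesis h_linear : forall i j, linear (h i j).
Hypothesis hM : forall i j i' j' a b,
  h i j a ** h i' j' b = if j == i' then h i j' (a ** b) else 0.

Definition mxN_lift : alg_hom (mxN_alg A) B.
Proof.
apply: (@sg_lift l A B _ mxunit_sg (fun k => h k.1 k.2) (fun k => h_linear k.1 k.2)).
by move=> [i j] [i' j'] a b /=; rewrite hM /mxunit_op /=; case: eqP.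
Defined.

Lemma mxN_liftE i j a : mxN_lift (mxterm i j a) = h i j a.
Proof. exact: sg_liftU. Qed.

End MatrixLift.

Section MatrixEntrywise.
Variables (l : comPzRingType) (A B : nuAlgType l).
Variable m : nat -> nat -> A -> B.
Hypothesis m_linear : forall i j, linear (m i j).
Hypothesis mM : forall i j k a b, m i j a ** m j k b = m i k (a ** b).

(** The typical family is [m i j a] = p_i a q_j with q_j p_j = 1: conjugation by an infinite
    diagonal matrix, which need not lie in the matrix algebra itself. *)
Definition mxN_entry : alg_hom (mxN_alg A) (mxN_alg B).
Proof.
apply: (@mxN_lift l A (mxN_alg B) (fun i j a => mxterm i j (m i j a))).
- by move=> i j c a b; rewrite m_linear linearP.
- by move=> i j i' j' a b; rewrite mxtermM; case: eqP => // <-; rewrite mM.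
Defined.

Lemma mxN_entryE i j a : mxN_entry (mxterm i j a) = mxterm i j (m i j a).
Proof. exact: mxN_liftE. Qed.

Definition mxN_diag i : alg_hom A B := AlgHom (m_linear i i) (fun a b => esym (mM i i i a b)).

Lemma mxN_entry_incl i :
  alg_comp mxN_entry (mxN_incl A i) = alg_comp (mxN_incl B i) (mxN_diag i).
Proof. by apply: alg_hom_ext => a; exact: mxN_entryE. Qed.

End MatrixEntrywise.

Section Relabel.
Variables (l : comPzRingType) (A : nuAlgType l).

(** This is x |-> U_s x U_s'^T for 0-1 matrices U_s of infinite support. Rows and columns are
    relabelled separately, so that one-sided multiplication is available too. *)
Definition mx_relabel (s s' : nat -> nat) : mxN_alg A -> mxN_alg A :=
  @sg_lift_fun l A (mxN_alg A) _ mxunit_sg (fun k => mxterm (s k.1) (s' k.2)).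

Fact mx_relabel_linear s s' : linear (mx_relabel s s').
Proof. by apply: sg_lift_linear => k; exact: mxterm_linear. Qed.

HB.instance Definition _ s s' := GRing.isLinear.Build l (mxN_alg A) (mxN_alg A)
  *:%R (mx_relabel s s') (mx_relabel_linear s s').

Lemma mx_relabelE s s' i j a :
  mx_relabel s s' (mxterm i j a) = mxterm (s i) (s' j) a.
Proof.
by apply: sg_lift_funU => k; exact: mxterm_linear.
Qed.

(** For injective s', the inner factor U_s'^T U_s' is the identity. *)
Lemma mx_relabelM s s' s'' x y : injective s' ->
  mx_relabel s s' x ** mx_relabel s' s'' y = mx_relabel s s'' (x ** y).
Proof.
move=> s'_inj; rewrite [x](@monalgE _ A) [y](@monalgE _ A).
rewrite raddf_sum !amul_suml [RHS]raddf_sum; apply: eq_bigr => -[i j] _.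
rewrite raddf_sum !amul_sumr [RHS]raddf_sum; apply: eq_bigr => -[i' j'] _.
rewrite -[LHS]/(mx_relabel _ _ (mxterm _ _ _) ** mx_relabel _ _ (mxterm _ _ _)).
rewrite -[RHS]/(mx_relabel _ _ (mxterm _ _ _ ** mxterm _ _ _)).
rewrite !mx_relabelE !mxtermM (inj_eq s'_inj).
by case: eqP => _; rewrite ?mx_relabelE ?raddf0.
Qed.

Lemma mx_relabel_id x : mx_relabel id id x = x.
Proof.
rewrite [x in LHS](@monalgE _ A) [RHS](@monalgE _ A) raddf_sum.
by apply: eq_bigr => -[i j] _; exact: mx_relabelE.
Qed.

End Relabel.

Lemma fmap_algcomp (l : comPzRingType) (D : category) (Y : functor (Alg l) D)
    (A B C : Alg l) (g : alg_hom B C) (f : alg_hom A B) :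
  fmap Y (alg_comp g f : hom A C) =
  fmap Y (g : hom B C) \oc fmap Y (f : hom A B).
Proof. exact: (fmap_comp Y (g : hom B C) (f : hom A B)). Qed.

Section Iso.
Variable C : category.

Lemma iso_monic (A B X : C) (f : hom A B) (u v : hom X A) :
  is_iso f -> f \oc u = f \oc v -> u = v.
Proof.
case=> g [gf _] /(congr1 (fun w => g \oc w)).
by rewrite !compmA gf !comp1m.
Qed.

Lemma iso_epic (A B X : C) (f : hom A B) (u v : hom B X) :
  is_iso f -> u \oc f = v \oc f -> u = v.
Proof.
case=> g [_ fg] /(congr1 (fun w => w \oc g)).
by rewrite -!compmA fg !compm1.
Qed.

Lemma iso_comp (A B X : C) (g : hom B X) (f : hom A B) :
  is_iso g -> is_iso f -> is_iso (g \oc f).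
Proof.
move=> [g' [g'g gg']] [f' [f'f ff']]; exists (f' \oc g'); split.
- by rewrite -compmA (compmA g') g'g comp1m.
- by rewrite -compmA (compmA f) ff' comp1m.
Qed.

(** A right inverse of [g \oc f] and a left inverse of [h \oc g] provide a right and a left inverse
    of [g], which then coincide. *)
Lemma iso_2of6 (A B X Z : C) (f : hom A B) (g : hom B X) (h : hom X Z) :
  is_iso (g \oc f) -> is_iso (h \oc g) -> is_iso g.
Proof.
move=> [u [_ gfu]] [v [vhg _]].
have e : v \oc h = f \oc u.
  rewrite -[LHS]compm1 -gfu -(compmA g) (compmA (v \oc h)) -(compmA v h g) vhg.
  by rewrite comp1m.
exists (f \oc u); split; first by rewrite -e -compmA.
by rewrite compmA.
Qed.

End Iso.

Section MatrixStable.
Variables (l : comPzRingType) (D : category) (Y : functor (Alg l) D).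
Hypothesis Ystable : matrix_stable Y.

Local Notation "'Y1' f" := (fmap Y (f : @hom (Alg l) _ _)) (at level 10, f at level 8).

Lemma mxN_incl0 (A : nuAlgType l) : mxN_incl A 0 = mxN_corner A.
Proof. exact: alg_hom_ext. Qed.

Lemma incl0_iso (A : nuAlgType l) : is_iso (Y1 (mxN_incl A 0)).
Proof. by rewrite mxN_incl0; exact: Ystable. Qed.

Definition swap01 (n : nat) : nat :=
  if n == 0%N then 1%N else if n == 1%N then 0%N else n.

Lemma swap01K : involutive swap01.
Proof. by case=> [|[|n]]. Qed.

Lemma relabel_swapM (A : nuAlgType l) (i j k : bool) (x y : mxN_alg A) :
  let s (b : bool) := if b then swap01 else id in
  mx_relabel (s i) (s j) x ** mx_relabel (s j) (s k) y = mx_relabel (s i) (s k) (x ** y).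
Proof.
move=> s; apply: mx_relabelM; case: j => //=; exact: inv_inj swap01K.
Qed.

Definition mx_swap (A : nuAlgType l) : alg_hom (mxN_alg A) (mxN_alg A) :=
  AlgHom (mx_relabel_linear (A := A) swap01 swap01)
    (fun x y => esym (relabel_swapM true true true x y)).

Lemma mx_swapK (A : nuAlgType l) : alg_comp (mx_swap A) (mx_swap A) = alg_id (mxN_alg A).
Proof.
apply: sgalg_hom_ext => a [i j]; rewrite -!/(mxterm i j a) /=.
by rewrite !mx_relabelE !swap01K.
Qed.

Lemma mx_swap_incl (A : nuAlgType l) : alg_comp (mx_swap A) (mxN_incl A 0) = mxN_incl A 1.
Proof. by apply: alg_hom_ext => a; exact: mx_relabelE. Qed.

Lemma incl1_iso (A : nuAlgType l) : is_iso (Y1 (mxN_incl A 1)).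
Proof.
rewrite -mx_swap_incl fmap_algcomp; apply: iso_comp; last exact: incl0_iso.
by exists (Y1 (mx_swap A)); rewrite -!fmap_algcomp mx_swapK; split; exact: fmap_id.
Qed.

(* The swap is conjugation by a permutation matrix U; conjugation by
   diag(U, 1, 1, ...) fixes the image of [mxN_incl _ 1], so it is killed by Y. *)
Lemma fmap_swap (A : nuAlgType l) : Y1 (mx_swap A) = idm (Y (mxN_alg A : Alg l)).
Proof.
pose s (i : nat) (b := i == 0%N) : nat -> nat := if b then swap01 else id.
pose m i j := @mx_relabel l A (s i) (s j).
have mM i j k x y : m i j x ** m j k y = m i k (x ** y).
  exact: (relabel_swapM (i == 0%N) (j == 0%N) (k == 0%N)).
have mlin i j : linear (m i j) by exact: mx_relabel_linear.
have e1 : Y1 (mxN_entry mlin mM) = idm _.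
  apply: (iso_epic (incl1_iso (mxN_alg A))).
  rewrite -fmap_algcomp mxN_entry_incl comp1m; congr (fmap Y _).
  apply: alg_hom_ext => x /=; congr (mxterm _ _ _); exact: mx_relabel_id.
apply: (iso_monic (incl0_iso (mxN_alg A))).
rewrite compm1 -[RHS]comp1m -e1 -!fmap_algcomp mxN_entry_incl; congr (fmap Y _).
exact: alg_hom_ext.
Qed.

Lemma fmap_incl1 (A : nuAlgType l) : Y1 (mxN_incl A 1) = Y1 (mxN_incl A 0).
Proof. by rewrite -mx_swap_incl fmap_algcomp fmap_swap comp1m. Qed.

(** By [mxN_entry_incl], each diagonal map followed by an inclusion factors through the same
    [mxN_entry], and [Y] identifies the inclusions at places 0 and 1. *)
Lemma fmap_entry_diag (A B : nuAlgType l) (m : nat -> nat -> A -> B)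
    (mlin : forall i j, linear (m i j))
    (mM : forall i j k a b, m i j a ** m j k b = m i k (a ** b)) :
  Y1 (mxN_diag mlin mM 0) = Y1 (mxN_diag mlin mM 1).
Proof.
apply: (iso_monic (incl0_iso B)); rewrite -[in RHS]fmap_incl1 -!fmap_algcomp.
by rewrite -!(mxN_entry_incl mlin mM) !fmap_algcomp fmap_incl1.
Qed.

End MatrixStable.

(** * Galois extensions and crossed products *)

Section MatrixOf.
Variables (l : comPzRingType) (B : nuAlgType l).

Definition mx_of m n (E : 'I_m -> 'I_n -> B) : mxN_alg B :=
  \sum_(i < m) \sum_(j < n) mxterm i j (E i j).

Lemma mx_ofM m n p (E : 'I_m -> 'I_n -> B) (E' : 'I_n -> 'I_p -> B) :
  mx_of E ** mx_of E' = mx_of (fun i k => \sum_j E i j ** E' j k).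
Proof.
rewrite /mx_of amul_suml; apply: eq_bigr => i _; rewrite amul_suml.
under [RHS]eq_bigr do rewrite raddf_sum.
rewrite [RHS]exchange_big; apply: eq_bigr => j _ /=.
rewrite amul_sumr (bigD1 j) //= [X in _ + X]big1 ?addr0 => [|j' /negbTE j'j].
  by rewrite amul_sumr; apply: eq_bigr => k _; rewrite mxtermM eqxx.
rewrite amul_sumr big1 // => k _; rewrite mxtermM.
by rewrite (_ : (val j == val j') = false) // eq_sym; exact: j'j.
Qed.

Lemma eq_mx_of m n (E E' : 'I_m -> 'I_n -> B) :
  (forall i j, E i j = E' i j) -> mx_of E = mx_of E'.
Proof. by move=> ee; do 2!apply: eq_bigr => ? _; rewrite ee. Qed.

Fact mx_of_linear (A : lmodType l) m n (th : 'I_m -> 'I_n -> A -> B) :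
  (forall i j, linear (th i j)) -> linear (fun a => mx_of (fun i j => th i j a)).
Proof.
move=> thL c a b; rewrite /mx_of scaler_sumr -big_split; apply: eq_bigr => i _ /=.
rewrite scaler_sumr -big_split; apply: eq_bigr => j _ /=.
by rewrite thL linearP.
Qed.

End MatrixOf.

Section FiniteCorner.
Variables (l : comPzRingType) (D : category) (Y : functor (Alg l) D).
Hypothesis Ystable : matrix_stable Y.
Variables (S : nuAlgType l) (e : S).
Hypotheses (emul : left_id e amul) (mule : right_id e amul).
Variables (n : nat) (P Q : 'I_n.+1 -> S).
Hypothesis QP : \sum_j Q j ** P j = e.

(** [true] selects the given column and row, [false] the first unit vectors; in both cases q p =
    e. *)
Let p (b : bool) i := if b then P i else if i == ord0 then e else 0.
Let q (b : bool) i := if b then Q i else if i == ord0 then e else 0.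

Let qp b : \sum_j q b j ** p b j = e.
Proof.
case: b => //=; rewrite (bigD1 ord0) //= big1 ?addr0 => [|j /negbTE ->].
  by rewrite emul.
by rewrite amul0l.
Qed.

Let rank1 (b c : bool) (s : S) : mxN_alg S := mx_of (fun i j => p b i ** s ** q c j).

Let rank1_linear b c : linear (rank1 b c).
Proof.
apply: mx_of_linear => i j x s t.
by rewrite amulDr amulDl amulZr amulZl.
Qed.

Let rank1M b c d s t : rank1 b c s ** rank1 c d t = rank1 b d (s ** t).
Proof.
rewrite /rank1 mx_ofM; apply: eq_mx_of => i k.
under eq_bigr => j _.
  rewrite -(amulA (p b i ** s)) (amulA (q c j)) (amulA (q c j)).
over.
rewrite -amul_sumr -!amul_suml qp emul.
by rewrite !amulA.
Qed.

(** Both maps are diagonal members of one family, so [fmap_entry_diag] compares them: place 0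
    carries [P] and [Q], every other place the unit vectors, which give the corner. *)
Lemma fmap_conj (f : alg_hom S (mxN_alg S)) :
  (forall s, f s = mx_of (fun i j => P i ** s ** Q j)) ->
  fmap Y (f : @hom (Alg l) _ _) = fmap Y (mxN_corner S : @hom (Alg l) _ _).
Proof.
move=> fE; pose m (i j : nat) := rank1 (i == 0%N) (j == 0%N).
have mlin i j : linear (m i j) by exact: rank1_linear.
have mM i j k a b : m i j a ** m j k b = m i k (a ** b) by exact: rank1M.
have -> : f = mxN_diag mlin mM 0 by apply: alg_hom_ext => s; rewrite fE.
rewrite (fmap_entry_diag Ystable); congr (fmap Y _).
apply: alg_hom_ext => s /=; rewrite /m /rank1 /mx_of /=.
rewrite (bigD1 ord0) //= [X in _ + X]big1 ?addr0 => [|i /negbTE i0].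
  rewrite (bigD1 ord0) //= big1 ?addr0 => [|j /negbTE j0]; first by rewrite emul mule.
  by rewrite j0 amul0r raddf0.
by rewrite big1 // => j _; rewrite i0 !amul0l raddf0.
Qed.

End FiniteCorner.

Section GaloisMorita.
Variables (l : comPzRingType) (gT : finGroupType) (A : galgebra l gT).
Variable one : A.
Hypotheses (amulC : commutative (@amul l A)) (amul1 : left_id one amul).
Variables (R : nuAlgType l) (oneR : R).
Variables (iota : alg_hom R A) (tr : {linear A -> R}).
Hypothesis iota_inj : injective iota.
Hypothesis iota1 : iota oneR = one.
Hypothesis iota_act : forall g r, galg_act A g (iota r) = iota r.
Hypothesis iota_tr : forall a, iota (tr a) = \sum_g galg_act A g a.
Variables (n : nat) (x y : 'I_n.+1 -> A).
Hypothesis galois : forall g,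
  \sum_j x j ** galg_act A g (y j) = if g == 1%g then one else 0.
Variable c : A.
Hypothesis tr_c : tr c = oneR.

Local Notation "g • a" := (galg_act A g a) (at level 35).
Local Notation S := (crossed A).

Lemma galg_act_one g : g • one = one.
Proof. by rewrite -iota1 iota_act. Qed.

Lemma tr_iotar a r : tr (a ** iota r) = tr a ** r.
Proof.
apply: iota_inj; rewrite alg_homM !iota_tr amul_suml.
by apply: eq_bigr => g _; rewrite alg_homM iota_act.
Qed.

Definition crossed_one : S := crossed_elt (A := A) one 1%g.

Lemma crossed_mulE (u v : S) k :
  (u ** v) k = \sum_h u h ** (h • v (h^-1 * k)%g).
Proof. by rewrite ffunE. Qed.

Lemma crossed_mul1 : left_id crossed_one amul.
Proof.
move=> u; apply/ffunP => k; rewrite crossed_mulE (bigD1 1%g) //= big1 ?addr0.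
  by rewrite ffunE eqxx invg1 mul1g galg_act1 amul1.
by move=> h /negbTE h1; rewrite ffunE h1 amul0l.
Qed.

Lemma crossed_1mul : right_id crossed_one amul.
Proof.
move=> u; apply/ffunP => k; rewrite crossed_mulE (bigD1 k) //= big1 ?addr0.
  by rewrite mulVg ffunE eqxx galg_act_one amulC amul1.
move=> h hk; rewrite ffunE ifN ?alg_hom0 ?amul0r //.
by apply: contra hk => /eqP hk; rewrite -(mulKVg h k) hk mulg1.
Qed.

(** The action of A x| G on A, which is R-linear by [crossed_app_iota]. *)
Definition crossed_app (s : S) (a : A) : A := \sum_g s g ** (g • a).

Fact crossed_app_linearl a : linear (crossed_app^~ a).
Proof.
move=> d s t; rewrite /crossed_app scaler_sumr -big_split; apply: eq_bigr => g _ /=.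
by rewrite !ffunE amulDl amulZl.
Qed.

Lemma crossed_appM s t a : crossed_app (s ** t) a = crossed_app s (crossed_app t a).
Proof.
rewrite /crossed_app; under eq_bigr do rewrite crossed_mulE amul_suml.
rewrite exchange_big; apply: eq_bigr => g _ /=.
rewrite (reindex (fun h => (g * h)%g)) /=; last first.
  by exists (fun h => (g^-1 * h)%g) => h _; rewrite ?mulKg ?mulKVg.
rewrite alg_hom_sum amul_sumr; apply: eq_bigr => h _.
by rewrite mulKg alg_homM galg_actM amulA.
Qed.

Lemma crossed_app_iota s a r : crossed_app s (a ** iota r) = crossed_app s a ** iota r.
Proof.
rewrite /crossed_app amul_suml; apply: eq_bigr => g _.
by rewrite alg_homM iota_act amulA.
Qed.

Lemma crossed_app_sum s (I : finType) (F : I -> A) :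
  crossed_app s (\sum_i F i) = \sum_i crossed_app s (F i).
Proof.
rewrite /crossed_app [RHS]exchange_big; apply: eq_bigr => g _ /=.
by rewrite alg_hom_sum amul_sumr.
Qed.

(** The x_j and the functionals tr (y_j -) form a dual basis of A over R: after expanding the trace
    and exchanging the sums, [galois] leaves only the term g = 1. *)
Lemma galois_basis a : \sum_j x j ** iota (tr (y j ** a)) = a.
Proof.
under eq_bigr do rewrite iota_tr amul_sumr.
rewrite exchange_big /=.
under eq_bigr => g _ do
  (under eq_bigr do rewrite alg_homM amulA; rewrite -amul_suml galois).
rewrite (bigD1 1%g) //= big1 ?addr0 => [|g /negbTE ->]; last by rewrite amul0l.
by rewrite eqxx galg_act1 amul1.
Qed.

(** The matrix of the operator [s] in this dual basis. *)
Let theta (i j : 'I_n.+1) (s : S) : R := tr (y i ** crossed_app s (x j)).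

Let theta_linear i j : linear (theta i j).
Proof.
by move=> d s t; rewrite /theta crossed_app_linearl amulDr amulZr linearP.
Qed.

Let thetaM s t i k : \sum_j theta i j s ** theta j k t = theta i k (s ** t).
Proof.
rewrite /theta crossed_appM -[in RHS](galois_basis (crossed_app t (x k))).
rewrite crossed_app_sum amul_sumr raddf_sum; apply: eq_bigr => j _.
rewrite crossed_app_iota amulA; apply: esym; exact: tr_iotar.
Qed.

Let phi : alg_hom S (mxN_alg R).
Proof.
exists (fun s => mx_of (fun i j => theta i j s)).
  by apply: mx_of_linear; exact: theta_linear.
by move=> s t; rewrite mx_ofM; apply: eq_mx_of => i k; rewrite thetaM.
Defined.

(** With t the sum of all group elements, this is r c t. It is multiplicative in r because t a t =
    tr(a) t and tr(c) = 1. *)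
Let psi_fun (r : R) : S := [ffun=> iota r ** c].

Let psi_linear : linear psi_fun.
Proof.
by move=> d r t; apply/ffunP => g; rewrite !ffunE alg_homD alg_homZ amulDl amulZl.
Qed.

Let sum_act_c : \sum_h (h • c) = one.
Proof. by rewrite -iota_tr tr_c. Qed.

Let psi : alg_hom R S.
Proof.
exists psi_fun; first exact: psi_linear.
move=> r t; apply/ffunP => k; rewrite crossed_mulE !ffunE.
under eq_bigr do rewrite !ffunE alg_homM iota_act amulA.
rewrite -amul_sumr sum_act_c [RHS]amulC amul1 alg_homM -!amulA; congr (_ ** _).
exact: amulC.
Defined.

Let psi_entry : alg_hom (mxN_alg R) (mxN_alg S) :=
  mxN_entry (m := fun _ _ => psi) (fun _ _ => alg_hom_linear psi)
    (fun _ _ _ a b => esym (alg_homM psi a b)).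

Let iso_phi (D : category) (Y : functor (Alg l) D) : matrix_stable Y ->
  is_iso (fmap Y (phi : @hom (Alg l) _ _)).
Proof.
move=> Ystable.
have mul1R : left_id oneR amul.
  by move=> r; apply: iota_inj; rewrite alg_homM iota1 amul1.
have mulR1 : right_id oneR amul.
  by move=> r; apply: iota_inj; rewrite alg_homM iota1 amulC amul1.
(* [phi] sits between [psi] and [psi_entry]; both composites have the form P s Q, to which
   [fmap_conj] applies. *)
apply: (iso_2of6 (f := fmap Y (psi : @hom (Alg l) _ _))
                 (h := fmap Y (psi_entry : @hom (Alg l) _ _))).
  rewrite -fmap_algcomp.
  rewrite (@fmap_conj l D Y Ystable R oneR mul1R mulR1 n
             (fun i => tr (y i ** c)) (fun j => tr (x j))) //.
  (* Here Q P is the sum of the tr(x_j) tr(y_j c), which is tr(c) = 1 by R-linearity and the dual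
     basis. *)
  - under eq_bigr do rewrite -tr_iotar.
    by rewrite -raddf_sum galois_basis.
  - move=> r; apply: eq_mx_of => i j.
    rewrite /theta /crossed_app.
    under eq_bigr do rewrite ffunE -amulA.
    rewrite -amul_sumr -amul_sumr -iota_tr !amulA.
    by rewrite tr_iotar -(amulA (y i)) (amulC (iota r)) amulA tr_iotar.
rewrite -fmap_algcomp.
(* That is, P_i = c t y_i and Q_j = x_j t. Since t c t = t, Q P is the sum of the x_j t y_j, which
   is 1 by [galois]. Moreover P_i s Q_j = c tr(y_i s(x_j)) t is [psi (theta i j s)]. *)
rewrite (@fmap_conj l D Y Ystable S crossed_one crossed_mul1 crossed_1mul n
  (fun i => [ffun h => c ** (h • y i)]) (fun j => [ffun=> x j])) //.
- apply/ffunP => k; rewrite sum_ffunE ffunE -galois.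
  under eq_bigr => j _.
    rewrite crossed_mulE.
    under eq_bigr do rewrite !ffunE alg_homM -galg_actM mulKVg (amulC (_ • c)) amulA.
    rewrite -amul_sumr sum_act_c amulC amul1.
  over.
  by [].
- move=> s; rewrite -[LHS]/(psi_entry (mx_of (fun i j => theta i j s))) /mx_of.
  rewrite alg_hom_sum; apply: eq_bigr => i _.
  rewrite alg_hom_sum; apply: eq_bigr => j _.
  rewrite mxN_entryE; congr (mxterm _ _ _).
  apply/ffunP => k; rewrite [LHS]ffunE -(amulA _ s) crossed_mulE.
  have sQ h : (s ** ([ffun=> x j] : S)) h = crossed_app s (x j).
    by rewrite crossed_mulE; apply: eq_bigr => g _; rewrite ffunE.
  under eq_bigr do rewrite ffunE sQ -amulA -alg_homM.
  by rewrite -amul_sumr -iota_tr amulC.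
Qed.

(** The isomorphism comes from the zigzag A x| G --phi--> M_N R <--corner-- R. *)
Lemma galois_morita (D : category) (Y : functor (Alg l) D) : matrix_stable Y ->
  isomorphic (Y (crossed A : Alg l)) (Y (R : Alg l)).
Proof.
move=> Ystable; have [g [gf fg]] := Ystable R.
exists (g \oc fmap Y (phi : @hom (Alg l) _ _)).
apply: iso_comp; last exact: iso_phi.
by exists (fmap Y (mxN_corner R : @hom (Alg l) _ _)).
Qed.

End GaloisMorita.

(** * Words *)

Definition stutterfree (T : eqType) (w : seq T) : bool :=
  sorted (fun x y => x != y) w.

Section WordPoly.
Variables (T : eqType) (K : comPzRingType).
Implicit Types (w u : seq T) (s : seq (T * K)).

(* The coefficient of w in the product of the 1 + t x_y, for (y, t) in s, in
   noncommuting variables x_y with x_y x_y = 0. *)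
Fixpoint word_poly w s : K :=
  match w, s with
  | [::], _ => 1
  | _ :: _, [::] => 0
  | x :: w', (y, t) :: s' =>
      word_poly w s' + (if x == y then t * word_poly w' s' else 0)
  end.
Arguments word_poly : simpl never.

Lemma word_poly0 s : word_poly [::] s = 1. Proof. by case: s. Qed.

Lemma word_poly_nil w : word_poly w [::] = (w == [::])%:R.
Proof. by case: w. Qed.

Lemma word_poly_cons w y t s : word_poly w ((y, t) :: s) =
  word_poly w s + (if ohead w == Some y then t * word_poly (behead w) s else 0).
Proof. by case: w => [|x w] //; rewrite !word_poly0 addr0. Qed.

Lemma word_poly_long w s : (size s < size w)%N -> word_poly w s = 0.
Proof.
elim: s w => [|[y t] s IH] [|x w] //= sw.
by rewrite word_poly_cons !IH ?mulr0 ?if_same ?addr0 // ltnW.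
Qed.

Lemma word_poly_zero (I : Type) (r : seq I) (c : I -> T) (t : I -> K) w :
  (forall i, t i = 0) -> word_poly w [seq (c i, t i) | i <- r] = word_poly w [::].
Proof.
move=> t0; elim: r => //= i r IH.
by rewrite word_poly_cons IH t0 mul0r if_same addr0.
Qed.

Lemma word_poly1 x s : word_poly [:: x] s = \sum_(p <- s | p.1 == x) p.2.
Proof.
elim: s => [|[y t] s IH]; first by rewrite big_nil.
rewrite word_poly_cons IH big_cons /= word_poly0 mulr1 (inj_eq (@Some_inj _)).
by rewrite eq_sym; case: eqP => _; rewrite ?addr0 // addrC.
Qed.

(* As x_y x_y = 0, one has (1 + t x_y) (1 + t' x_y) = 1 + (t + t') x_y. *)
Lemma word_poly_merge (J : eqType) (r : seq J) (a : J -> nat) (c : nat -> T) (t : J -> K)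
    lo len w :
  sorted leq (map a r) -> all (fun j => (lo <= a j < lo + len)%N) r -> stutterfree w ->
  word_poly w [seq (c (a j), t j) | j <- r] =
  word_poly w [seq (c i, \sum_(j <- r | a j == i) t j) | i <- iota lo len].
Proof.
elim: r lo len w => [|j r IH] lo len w /=.
  by move=> _ _ _; rewrite word_poly_zero // => i; rewrite big_nil.
move=> ra /andP[/andP[loj jlen] rlen] ww.
have [rs aj_le] : sorted leq (map a r) /\ all (fun j' => a j <= a j')%N r.
  split; first exact: path_sorted ra.
  have := order_path_min leq_trans ra.
  by rewrite all_map.
(* The remaining values of [a] are at least [a j], so the induction hypothesis is used on the range
   starting at [a j]. *)
have {}IH v : stutterfree v -> word_poly v [seq (c (a j), t j) | j <- r] =
  word_poly v [seq (c i, \sum_(j <- r | a j == i) t j) |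
               i <- iota (a j) (lo + len - a j)].
  apply: IH => //; apply/allP => j' j'r; rewrite (allP aj_le) //=.
  by have /andP[_] := allP rlen _ j'r; rewrite subnKC // ltnW.
have split_iota : iota lo len =
  iota lo (a j - lo) ++ a j :: iota (a j).+1 (lo + len - a j).-1.
  rewrite -[in LHS](_ : (a j - lo) + (lo + len - a j).-1.+1 = len)%N.
    by rewrite iotaD subnKC.
  by rewrite prednK ?subn_gt0 // addnBA ?(ltnW jlen) // addnA subnK // addKn.
have iota_aj : iota (a j) (lo + len - a j) = a j :: iota (a j).+1 (lo + len - a j).-1.
  by rewrite -[in LHS](prednK (n := lo + len - a j)) ?subn_gt0.
(* No index is sent below [a j], so the factors there are trivial. *)
have drop v L : word_poly v ([seq (c i, \sum_(j0 <- j :: r | a j0 == i) t j0) |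
                  i <- iota lo (a j - lo)] ++ L) = word_poly v L.
  have : all (fun i => (i < a j)%N) (iota lo (a j - lo)).
    by apply/allP => i; rewrite mem_iota subnKC // => /andP[].
  elim: (iota lo _) => //= i q IHq /andP[ij qj].
  rewrite word_poly_cons IHq // big1_seq ?mul0r ?if_same ?addr0 // => j'.
  rewrite inE => /andP[/eqP ji] /orP[/eqP j'j|/(allP aj_le)].
    by rewrite -ji j'j ltnn in ij.
  by rewrite ji leqNgt ij.
rewrite split_iota map_cat drop /= !word_poly_cons !IH //; last first.
  by case: w ww => //= x w /path_sorted.
rewrite iota_aj /= big_cons eqxx.
have -> : [seq (c i, \sum_(j0 <- j :: r | a j0 == i) t j0) |
            i <- iota (a j).+1 (lo + len - a j).-1] =
          [seq (c i, \sum_(j0 <- r | a j0 == i) t j0) |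
            i <- iota (a j).+1 (lo + len - a j).-1].
  apply/eq_in_map => i; rewrite mem_iota => /andP[ji _].
  by rewrite big_cons ltn_eqF.
rewrite !word_poly_cons -addrA; congr (_ + _).
(* Using the letter [c (a j)] twice in a row would give an extra term on the left; it vanishes as
   the first two letters of the word differ. *)
case: w ww => [|x [|y w]] //= ; rewrite ?addr0 //.
  by rewrite !word_poly0 !mulr1; case: eqP; rewrite ?addr0 // addrC.
move=> /andP[xy _]; case: eqP => [[xj]|]; rewrite ?addr0 //.
by rewrite ifN ?addr0 ?mulrDl 1?addrC // -xj (inj_eq (@Some_inj _)) eq_sym.
Qed.

(* The product of the 1 + t x_y has the reversed product of the 1 - t x_y as
   inverse; this is the coefficient of u in that identity, up to sign. *)
Lemma word_poly_antipode u s : stutterfree u -> u != [::] ->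
  \sum_(i < (size u).+1)
     (-1) ^+ i * (word_poly (rev (take i u)) s * word_poly (drop i u) s) = 0.
Proof.
move=> uu u0; have n_gt0 : (0 < size u)%N by rewrite lt0n size_eq0.
have [x0 _] : exists x : T, true by case: (u) u0 => // x; exists x.
elim: s => [|[y t] s IH].
  apply: big1 => i _; rewrite !word_poly_nil -!size_eq0 size_rev size_takel -1?ltnS //.
  rewrite size_drop; have [->|_] := eqVneq (val i) 0%N; last by rewrite mul0r mulr0.
  by rewrite subn0 (gtn_eqF n_gt0) !mulr0.
(* The new factor adds [P i] to the coefficient of the reversed prefix, nonzero only if letter i-1
   of [u] is y, and [Q i] to that of the suffix, nonzero only if letter i is y. Hence P i Q i = 0,
   as [u] has no equal consecutive letters. *)
pose b i := (i < size u)%N && (nth x0 u i == y).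
pose p i := word_poly (rev (take i u)) s; pose q i := word_poly (drop i u) s.
pose P i := if i is i'.+1 then if b i' then t * p i' else 0 else 0.
pose Q i := if b i then t * q i.+1 else 0.
have pE (i : 'I_(size u).+1) : word_poly (rev (take i u)) ((y, t) :: s) = p i + P i.
  case: i => -[|i] iu; first by rewrite take0 /p take0 !word_poly0 addr0.
  have iu' : (i < size u)%N by [].
  rewrite word_poly_cons /P /b /p /=.
  by rewrite (take_nth x0) // rev_rcons /= iu' /= (inj_eq (@Some_inj _)).
have qE (i : 'I_(size u).+1) : word_poly (drop i u) ((y, t) :: s) = q i + Q i.
  rewrite word_poly_cons /Q /b /q; congr (_ + _).
  have [iu|ui] := ltnP i (size u); last by rewrite drop_oversize.
  by rewrite (drop_nth x0) //= (inj_eq (@Some_inj _)).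
have PQ i : P i * Q i = 0.
  case: i => [|i]; rewrite /P ?mul0r // /Q /b.
  have [/eqP iy|] := boolP (nth x0 u i == y); last by rewrite andbF mul0r.
  rewrite (_ : (i.+1 < size u)%N && _ = false) ?mulr0 //; apply/negP => /andP[iu /eqP i1y].
  have /sortedP := uu => /(_ x0 i iu).
  by rewrite iy i1y eqxx.
under eq_bigr => i _.
  rewrite pE qE mulrDl !mulrDr PQ mulr0 addr0 -addrA [X in _ + X]addrC.
over.
(* The rest cancels in pairs: P (i+1) q (i+1) and p i Q i both equal t p_i q_(i+1) when letter i is
   y, and carry opposite signs. *)
rewrite big_split /= IH add0r big_split /= big_ord_recl [P _]/= mul0r mulr0 add0r.
rewrite big_ord_recr /= [Q (size u)]/Q {2}/b ltnn /= !mulr0 addr0 -big_split big1 // => i _ /=.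
rewrite exprS mulN1r /bump /= add1n mulNr /Q.
by case: (b i); rewrite ?mul0r ?mulr0 ?oppr0 ?addr0 // -mulrA (mulrCA (p i)) addNr.
Qed.

End WordPoly.

Lemma word_poly_relabel (T T' : eqType) (K : comPzRingType) (h : T -> T') w
    (s : seq (T * K)) :
  injective h -> word_poly (map h w) [seq (h p.1, p.2) | p <- s] = word_poly w s.
Proof.
move=> h_inj; elim: s w => [|[y t] s IH] w; first by case: w.
case: w => [|x w]; first by rewrite !word_poly0.
rewrite !word_poly_cons IH /= IH !(inj_eq (@Some_inj _)) (inj_eq h_inj).
by [].
Qed.

Lemma rmorph_word_poly (T : eqType) (K K' : comPzRingType) (f : {rmorphism K -> K'}) w
    (s : seq (T * K)) :
  f (word_poly w s) = word_poly w [seq (p.1, f p.2) | p <- s].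
Proof.
elim: s w => [|[y t] s IH] w; first by rewrite !word_poly_nil rmorph_nat.
by rewrite !word_poly_cons rmorphD IH; case: eqP => _; rewrite ?rmorph0 // rmorphM IH.
Qed.

Lemma stutterfree_rev (T : eqType) (w : seq T) : stutterfree (rev w) = stutterfree w.
Proof.
by rewrite /stutterfree rev_sorted; apply: eq_sorted => x y; rewrite eq_sym.
Qed.

Lemma stutterfree_rev_cat (T : eqType) (w v : seq T) :
  stutterfree w -> stutterfree v -> ohead w != ohead v -> stutterfree (rev w ++ v).
Proof.
case: w v => [|x w] [|y v] // ww vv; first by rewrite cats0 stutterfree_rev.
rewrite /= (inj_eq (@Some_inj _)) => xy; rewrite rev_cons cat_rcons.
have := ww; rewrite -stutterfree_rev rev_cons /stutterfree.
case: (rev w) => [|z r] /=; first by rewrite xy.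
by rewrite rcons_path cat_path /= => /andP[-> ->] /=; rewrite xy.
Qed.

(** * Galois data by induction on word length *)

Section Span.
Variables (A : comPzRingType) (G : finGroupType) (act : G -> A -> A) (f : seq G -> A).
Hypothesis act_f : forall g w, act g (f w) = f [seq (g * x)%g | x <- w].
Hypothesis f_letters : \sum_g f [:: g] = 1.
Hypothesis f_stutter : forall w, ~~ stutterfree w -> f w = 0.
Hypothesis f_antipode : forall u, stutterfree u -> u != [::] ->
  \sum_(i < (size u).+1) (-1) ^+ i * (f (rev (take i u)) * f (drop i u)) = 0.

Definition delta_fun (a : A) (g : G) : {ffun G -> A} := [ffun h => if h == g then a else 0].

(** As the coefficients [a] are arbitrary, closure under sums already gives an A-submodule.
    Functions with values in the ideal of the f_w with |w| >= k are sums of the delta generators. *)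
Inductive word_span (k : nat) : {ffun G -> A} -> Prop :=
| word_span0 : word_span k 0
| word_spanD u v : word_span k u -> word_span k v -> word_span k (u + v)
| word_span_orbit a b : word_span k [ffun g => a * act g b]
| word_span_delta a w g : (k <= size w)%N -> word_span k (delta_fun (a * f w) g).

Lemma word_span_sum k (I : Type) (r : seq I) (P : pred I) (F : I -> {ffun G -> A}) :
  (forall i, P i -> word_span k (F i)) -> word_span k (\sum_(i <- r | P i) F i).
Proof. by apply: big_ind; [exact: word_span0 | exact: word_spanD]. Qed.

Lemma delta_fun_sum (I : Type) (r : seq I) (P : pred I) (F : I -> A) g :
  delta_fun (\sum_(i <- r | P i) F i) g = \sum_(i <- r | P i) delta_fun (F i) g.
Proof.
apply/ffunP => h; rewrite ffunE sum_ffunE.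
under [RHS]eq_bigr do rewrite ffunE.
by case: eqP => // _; rewrite big1.
Qed.

Lemma ffun_delta_sum (u : {ffun G -> A}) : u = \sum_g delta_fun (u g) g.
Proof.
apply/ffunP => h; rewrite sum_ffunE (bigD1 h) //= ffunE eqxx big1 ?addr0 // => g gh.
by rewrite ffunE eq_sym (negbTE gh).
Qed.

(** Apply [f_antipode] to rev w ++ v: the cut at |w| gives f_w f_v up to sign, and at any other cut
    the prefix or the suffix is longer than |w| = |v|. *)
Lemma word_span_cross a w v g : size w = size v -> ohead w != ohead v ->
  word_span (size v).+1 (delta_fun (a * (f w * f v)) g).
Proof.
move=> wv hd.
have [ww|/f_stutter->] := boolP (stutterfree w); last first.
  have := @word_span_delta (size v).+1 0 (nseq (size v).+1 1%g) g.
  by rewrite !mul0r mulr0 size_nseq => /(_ (leqnn _)).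
have [vv|/f_stutter->] := boolP (stutterfree v); last first.
  have := @word_span_delta (size v).+1 0 (nseq (size v).+1 1%g) g.
  by rewrite !mul0r !mulr0 size_nseq => /(_ (leqnn _)).
have uu := stutterfree_rev_cat ww vv hd; set u := rev w ++ v in uu.
have u0 : u != [::].
  rewrite -size_eq0 size_cat size_rev wv addn_eq0 andbb size_eq0.
  by case: (v) wv hd => //; case: (w).
have su : size u = (size w + size w)%N by rewrite size_cat size_rev wv.
have wu : (size w < (size u).+1)%N by rewrite su ltnS leq_addr.
have := f_antipode uu u0.
rewrite (bigD1 (Ordinal wu)) //= take_size_cat ?size_rev // revK drop_size_cat ?size_rev //.
move=> /(congr1 ( *%R ((-1) ^+ size w))).
rewrite mulr0 mulrDr mulrA -expr2 sqrr_sign mul1r => /eqP.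
rewrite addr_eq0 => /eqP ->; rewrite mulr_sumr -sumrN mulr_sumr delta_fun_sum.
apply: word_span_sum => i; rewrite -val_eqE /= => iw.
clearbody u; move: iw; rewrite neq_ltn => /orP[iw|wi].
- have -> : forall x y z z' : A, a * - (x * (y * (z * z'))) = - (a * x * y * z) * z'.
    by move=> x y z z'; rewrite mulrN mulNr !mulrA.
  apply: word_span_delta; rewrite size_drop -wv ltn_subRL.
  by apply: (@leq_trans (size w + size w)%N); rewrite ?ltn_add2r ?su.
- have -> : forall x y z z' : A, a * - (x * (y * (z * z'))) = - (a * x * y * z') * z.
    by move=> x y z z'; rewrite mulrN mulNr (mulrC z) !mulrA.
  apply: word_span_delta; rewrite -wv size_rev size_takel //.
  by rewrite -ltnS.
Qed.

Lemma word_span_mulf w u : word_span (size w) u -> (0 < size w)%N ->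
  word_span (size w).+1 [ffun g => f w * u g].
Proof.
move=> wu w0; elim: wu => {u} [|u v _ IHu _ IHv|a b|a v g wv].
- rewrite (_ : [ffun _ => _] = 0); first exact: word_span0.
  by apply/ffunP => g; rewrite !ffunE mulr0.
- rewrite (_ : [ffun _ => _] = [ffun g => f w * u g] + [ffun g => f w * v g]).
    exact: word_spanD.
  by apply/ffunP => g; rewrite !ffunE mulrDr.
- rewrite (_ : [ffun _ => _] = [ffun g => (f w * a) * act g b]).
    exact: word_span_orbit.
  by apply/ffunP => g; rewrite !ffunE mulrA.
rewrite (_ : [ffun _ => _] = delta_fun (f w * (a * f v)) g); last first.
  by apply/ffunP => h; rewrite !ffunE; case: eqP; rewrite ?mulr0.
move: wv; rewrite leq_eqVlt => /predU1P[wv|wv]; last first.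
  by rewrite mulrA; apply: word_span_delta.
have [hd|hd] := eqVneq (ohead w) (ohead v); last first.
  by rewrite mulrCA wv; apply: word_span_cross.
(* The delta at g is completed to the orbit function h |-> f_w a h(f_v'), which has the right value
   at g. For h != g, the first letter of h g^-1 v differs from that of w, so [word_span_cross]
   absorbs the error. *)
pose v' := [seq (g^-1 * x)%g | x <- v].
have actv h : act h (f v') = f [seq (h * g^-1 * x)%g | x <- v].
  by rewrite act_f -map_comp; congr f; apply: eq_map => x /=; rewrite mulgA.
have -> : delta_fun (f w * (a * f v)) g = [ffun h => (f w * a) * act h (f v')] +
    \sum_(h | h != g) delta_fun (- a * (f w * act h (f v'))) h.
  apply/ffunP => h; rewrite !ffunE sum_ffunE.
  have [->|hg] := eqVneq h g.
    rewrite big1 ?addr0 => [|k kg]; last by rewrite ffunE eq_sym (negbTE kg).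
    rewrite actv mulgV (_ : map _ v = v) ?mulrA //.
    by rewrite -[RHS]map_id; apply: eq_map => x; rewrite mul1g.
  rewrite (bigD1 h) //= ffunE eqxx big1 ?addr0 => [|k /andP[_ kh]].
    by rewrite mulNr mulrCA mulrA subrr.
  by rewrite ffunE eq_sym (negbTE kh).
apply: word_spanD; first exact: word_span_orbit.
apply: word_span_sum => h hg; rewrite actv wv.
rewrite -(size_map (fun x => h * g^-1 * x)%g v).
apply: word_span_cross; first by rewrite size_map.
case: (v) wv hd => [/eqP|x v1 _ /= ->]; first by rewrite (gtn_eqF w0).
rewrite (inj_eq (@Some_inj _)) -{1}(mul1g x) (inj_eq (mulIg x)) eq_sym.
by rewrite -eq_mulgV1.
Qed.

(** Level 1 follows from 1 being the sum of the f_(g). Then, for |w| = k, a delta of a f_w is f_w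
    times a delta already in the span, and [word_span_mulf] raises the level; it needs w nonempty in
    order to compare first letters. *)
Lemma word_span_full k u : word_span k.+1 u.
Proof.
(* Only the generators with words of length exactly m have to be improved. *)
have decomp m (IH : forall a w g, size w = m -> word_span m.+1 (delta_fun (a * f w) g)) v :
    word_span m v -> word_span m.+1 v.
  elim=> {v} [|v v' _ IHv _ IHv'|a b|a w g].
  - exact: word_span0.
  - exact: word_spanD.
  - exact: word_span_orbit.
  by rewrite leq_eqVlt => /predU1P[/esym|]; [exact: IH | exact: word_span_delta].
elim: k u => [|k IH] u.
  rewrite [u]ffun_delta_sum; apply: word_span_sum => g _.
  rewrite -[u g]mulr1 -f_letters mulr_sumr delta_fun_sum.
  by apply: word_span_sum => h _; exact: word_span_delta.
apply: decomp (IH u) => a w g wk.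
have := @word_span_mulf w (delta_fun a g); rewrite wk => /(_ (IH _) isT).
congr (word_span _ _); apply/ffunP => h; rewrite !ffunE.
by case: eqP; rewrite ?mulr0 // mulrC.
Qed.

(** At level N+1 the delta generators vanish, so a derivation for the indicator of 1 only uses orbit
    functions; the list collects their pairs (a, b). *)
Lemma galois_data N : (forall w, (N < size w)%N -> f w = 0) ->
  exists r : seq (A * A), forall g : G,
    \sum_(p <- r) p.1 * act g p.2 = if g == 1%g then 1 else 0.
Proof.
move=> f_long.
have [r rP] : exists r : seq (A * A), forall g : G,
    \sum_(p <- r) p.1 * act g p.2 = delta_fun 1 1%g g.
  elim: (word_span_full N (delta_fun 1 1%g)) => [|u v _ [r rP] _ [s sP]|a b|a w g /f_long ->].
  - by exists [::] => g; rewrite big_nil ffunE.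
  - by exists (r ++ s) => g; rewrite big_cat /= rP sP ffunE.
  - by exists [:: (a, b)] => g; rewrite big_seq1 ffunE.
  - by exists [::] => h; rewrite big_nil ffunE mulr0 if_same.
by exists r => g; rewrite rP ffunE.
Qed.

End Span.

(** * Galois data on free simplicial sets *)

Section SimplexMapMorphism.
Variables (l : comPzRingType) (m n : nat) (a : simp_op m n).

Fact simplex_map_zmod : zmod_morphism (@simplex_map l m n a).
Proof. by move=> x y; exact: (alg_homB (simplex_hom l a)). Qed.

Fact simplex_map_monoid : monoid_morphism (@simplex_map l m n a).
Proof.
split; last exact: simplex_mapM.
by rewrite -[1](rmorph1 (@simplex_pi l n)) simplex_mapE /simplex_subst !rmorph1.
Qed.

HB.instance Definition _ := GRing.isZmodMorphism.Build _ _ _ simplex_map_zmod.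
HB.instance Definition _ := GRing.isMonoidMorphism.Build _ _ _ simplex_map_monoid.

Definition bary (i : 'I_n.+1) : simplex_ring l n := simplex_pi (mvX l i).

End SimplexMapMorphism.

Lemma simplex_map_bary (l : comPzRingType) m n (a : simp_op m n) i :
  simplex_map a (bary l i) = \sum_(j | a j == i) bary l j.
Proof.
by rewrite simplex_mapE /simplex_subst mv_evalX rmorph_sum.
Qed.

Lemma sum_bary (l : comPzRingType) n : \sum_(i < n.+1) bary l i = 1.
Proof.
rewrite -(rmorph_sum (@simplex_pi l n)) -(rmorph1 (@simplex_pi l n)).
apply/simplex_piP; apply/simplex_idealP; exists 1.
by rewrite mul1r.
Qed.

Section PwPolyRing.
Variables (l : comPzRingType) (X : sset).
Local Notation T := (pwpoly l X).

Definition pw_one : T.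
Proof.
exists (fun n x => 1 : simplex_ring l n) => m n a x.
exact: esym (rmorph1 (@simplex_map l m n a)).
Defined.

Fact pw_mulC : commutative (@amul l T).
Proof. by move=> f g; apply: pw_ext => n x; exact: mulrC. Qed.

Fact pw_mul1 : left_id pw_one (@amul l T).
Proof. by move=> f; apply: pw_ext => n x; exact: mul1r. Qed.

HB.instance Definition _ := GRing.Zmodule_isComPzRing.Build T
  (@amulA l T) pw_mulC pw_mul1 (@amulDl l T).

Definition pw_ev n (x : X n) (f : T) : simplex_ring l n := pw_val f x.

Fact pw_ev_zmod n (x : X n) : zmod_morphism (pw_ev x).
Proof. by []. Qed.

Fact pw_ev_monoid n (x : X n) : monoid_morphism (pw_ev x).
Proof. by []. Qed.

HB.instance Definition _ n (x : X n) := GRing.isZmodMorphism.Build _ _ _ (pw_ev_zmod x).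
HB.instance Definition _ n (x : X n) := GRing.isMonoidMorphism.Build _ _ _ (pw_ev_monoid x).

Lemma pw_ev_sum n (x : X n) I (r : seq I) (P : pred I) (F : I -> T) :
  pw_ev x (\sum_(i <- r | P i) F i) = \sum_(i <- r | P i) pw_ev x (F i).
Proof. exact: (rmorph_sum (@pw_ev n x)). Qed.

Lemma pw_ev_signM n (x : X n) k (f : T) : pw_ev x ((-1) ^+ k * f) = (-1) ^+ k * pw_ev x f.
Proof. by rewrite rmorphM rmorphXn rmorphN rmorph1. Qed.

Lemma pw_evP (f g : T) : (forall n (x : X n), pw_ev x f = pw_ev x g) -> f = g.
Proof. exact: pw_ext. Qed.

End PwPolyRing.

Section SimplicialSets.

Definition vertex_op n (i : 'I_n.+1) : simp_op 0 n.
Proof.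
by exists [ffun=> i]; apply/forallP => j; apply/forallP => k; rewrite !ffunE leqnn implybT.
Defined.

Definition vertex (X : sset) n (x : X n) (i : 'I_n.+1) : X 0%N := sset_op (vertex_op i) x.

Lemma vertex_sset_op (X : sset) m n (a : simp_op m n) (x : X n) j :
  vertex (sset_op a x) j = vertex x (a j).
Proof.
rewrite /vertex -sset_op_comp; congr (sset_op _ x).
by apply: simp_op_ext => k; rewrite simp_compE /simp_fun !ffunE.
Qed.

Lemma vertex_act (gT : finGroupType) (X : sset) (act : sset_action gT X) g n (x : X n) i :
  vertex (act g n x) i = act g 0%N (vertex x i).
Proof. by rewrite /vertex sset_map_op. Qed.

Lemma nondegenerate_root (X : sset) n (x : X n) :
  exists m (a : simp_op n m) (y : X m), ~ degenerate y /\ x = sset_op a y.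
Proof.
elim/ltn_ind: n x => n IH x.
have [[m [a [y [mn _ ->]]]]|] := pselect (degenerate x); last first.
  by move=> nx; exists n, (simp_id n), x; rewrite sset_op_id.
have [k [b [z [nz ->]]]] := IH m mn y.
by exists k, (simp_comp b a), z; rewrite sset_op_comp.
Qed.

Lemma finite_sset_dim (X : sset) : finite_sset X ->
  exists N, forall n (x : X n), ~ degenerate x -> (n <= N)%N.
Proof.
move=> /(finite_image (fun x : {n & X n} => projT1 x)) /finite_seqP[s sE].
exists (\max_(i <- s) i) => n x nx.
suff ns : n \in s by apply: leq_bigmax_seq.
have : [set` s]%classic n by rewrite -sE; exists (existT _ n x).
by [].
Qed.

End SimplicialSets.

Section QuotientMap.
Variables (gT : finGroupType) (X : sset) (act : sset_action gT X).

Definition orbit_of n (x : X n) : quot_simplex act n :=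
  exist _ (sorbit act x) (ex_intro _ x erefl).

Definition orbit_rep n (O : quot_simplex act n) : X n := projT1 (cid (svalP O)).

Lemma quot_simplex_ext n (O O' : quot_simplex act n) : sval O = sval O' -> O = O'.
Proof. by case: O O' => [O HO] [O' HO'] /= OO'; exact: eq_exist. Qed.

Lemma orbit_repK n (O : quot_simplex act n) : orbit_of (orbit_rep O) = O.
Proof. by apply: quot_simplex_ext => /=; rewrite -(projT2 (cid (svalP O))). Qed.

Lemma orbit_of_act g n (x : X n) : orbit_of (act g n x) = orbit_of x.
Proof.
apply: quot_simplex_ext; apply/seteqP; split=> [_ [h _ <-]|_ [h _ <-]] /=.
  by exists (h * g)%g; rewrite ?sactM.
by exists (h * g^-1)%g => //; rewrite -sactM mulgKV.
Qed.

Lemma orbit_ofP n (x y : X n) : orbit_of x = orbit_of y -> exists g, x = act g n y.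
Proof.
move=> /(congr1 sval) /= xy.
have : sorbit act x x by exists 1%g; rewrite ?sact1.
by rewrite xy => -[g _ <-]; exists g.
Qed.

Lemma orbit_of_op m n (a : simp_op m n) (x : X n) :
  orbit_of (sset_op a x) = sset_op (s := quot_sset act) a (orbit_of x).
Proof. by apply: quot_simplex_ext => /=; rewrite sorbit_op. Qed.

(* A vertex labelling amounts to an equivariant map from X to the contractible
   free simplicial set EG. *)
Lemma free_vertex_label : free_action act ->
  exists c : X 0%N -> gT, forall g v, c (act g 0%N v) = (g * c v)%g.
Proof.
move=> free; pose r v := orbit_rep (orbit_of (v : X 0%N)).
(* [c v] carries the chosen representative of the orbit to [v]. By freeness there is only one such
   element, whence equivariance. *)
have /choice[c cP] : forall v, exists g, v = act g 0%N (r v).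
  by move=> v; apply: orbit_ofP; rewrite orbit_repK.
exists c => g v; have rv : r (act g 0%N v) = r v by rewrite /r orbit_of_act.
have e : act (c (act g 0%N v)) 0%N (r v) = act (g * c v)%g 0%N (r v).
  by rewrite -{1}rv -cP sactM -cP.
apply/eqP; rewrite eq_mulVg1; apply/eqP; apply: contrapT => /(free _ _ (r v)); apply.
by rewrite sactM -e -sactM mulVg sact1.
Qed.

End QuotientMap.

Section WordFunctions.
Variables (l : comPzRingType) (gT : finGroupType) (X : sset) (act : sset_action gT X).
Variable c : X 0%N -> gT.
Hypothesis c_act : forall g v, c (act g 0%N v) = (g * c v)%g.

Definition labels n (x : X n) : seq (gT * simplex_ring l n) :=
  [seq (c (vertex x i), bary l i) | i <- enum 'I_n.+1].

(** The operator [a] sends t_i to the sum of the t_j with a j = i, and these vertices all have the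
    label of vertex i; [word_poly_merge] merges their factors. *)
Lemma word_poly_sset_op m n (a : simp_op m n) (x : X n) w : stutterfree w ->
  word_poly w (labels (sset_op a x)) = simplex_map a (word_poly w (labels x)).
Proof.
move=> ww; rewrite rmorph_word_poly.
(* The labels are extended to all natural numbers; the default 1 is not reached on the range 0, ...,
   n. *)
pose cn k : gT := if insub k is Some i then c (vertex x i) else 1%g.
have cnE (i : 'I_n.+1) : cn i = c (vertex x i) by rewrite /cn valK.
have -> : labels (sset_op a x) = [seq (cn (a j), bary l j) | j <- enum 'I_m.+1].
  by apply: eq_map => j; rewrite vertex_sset_op cnE.
rewrite (@word_poly_merge _ _ _ _ (fun j => a j : nat) cn (bary l (n := m)) 0 n.+1) //.
- rewrite -val_enum_ord /labels -!map_comp; congr word_poly; apply: eq_map => i /=.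
  by rewrite cnE simplex_map_bary big_enum_cond.
- rewrite sorted_map; apply: (sub_sorted (e := relpre val leq)) => [i j|].
    exact: simp_opP.
  by rewrite -sorted_map val_enum_ord iota_sorted.
- by apply/allP => j _; rewrite add0n ltn_ord.
Qed.

(** On words with equal consecutive letters the formula can fail to commute with degeneracies, so
    the value is set to 0 there. *)
Definition word_fun (w : seq gT) : pwpoly l X.
Proof.
exists (fun n x => if stutterfree w then word_poly w (labels x) else 0 : simplex_ring l n).
move=> m n a x; case: ifP => [ww|_]; first exact: word_poly_sset_op.
by apply: esym; exact: (rmorph0 (@simplex_map l m n a)).
Defined.

Lemma word_funE w n (x : X n) :
  pw_ev x (word_fun w) = if stutterfree w then word_poly w (labels x) else 0.
Proof. by []. Qed.

Lemma word_fun_stutter w : ~~ stutterfree w -> word_fun w = 0.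
Proof. by move=> /negbTE ww; apply: pw_evP => n x; rewrite word_funE ww. Qed.

(** The barycentric coordinates, grouped by label, add up to 1. *)
Lemma word_fun_letters : \sum_g word_fun [:: g] = 1.
Proof.
apply: pw_evP => n x; rewrite pw_ev_sum -[RHS](sum_bary l n).
under eq_bigr do rewrite word_funE word_poly1 /labels big_map big_enum_cond.
rewrite [RHS](partition_big (fun i => c (vertex x i)) predT) //=.
Qed.

Lemma word_fun_antipode u : stutterfree u -> u != [::] ->
  \sum_(i < (size u).+1)
     (-1) ^+ i * (word_fun (rev (take i u)) * word_fun (drop i u)) = 0.
Proof.
move=> uu u0; apply: pw_evP => n x; rewrite pw_ev_sum.
rewrite -[RHS](word_poly_antipode (labels x) uu u0); apply: eq_bigr => i _.
rewrite pw_ev_signM -[pw_ev x _]/(pw_ev x _ * pw_ev x _) !word_funE.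
by rewrite stutterfree_rev /stutterfree take_sorted ?drop_sorted.
Qed.

(** Evaluation at g^-1 x sees the labels multiplied by g^-1, which amounts to multiplying the word
    by g. *)
Lemma word_fun_act g w : galg_act (pwpoly_galg l act) g (word_fun w) =
  word_fun [seq (g * x)%g | x <- w].
Proof.
apply: pw_evP => n x; rewrite word_funE -[LHS]/(pw_ev (act g^-1%g n x) (word_fun w)).
rewrite word_funE {1 2}/stutterfree sorted_map.
rewrite (eq_sorted (e' := fun x y => x != y)); last first.
  by move=> y z /=; rewrite (inj_eq (mulgI g)).
case: ifP => // _; rewrite -(word_poly_relabel w _ (mulgI g)) /labels -map_comp.
congr word_poly; apply: eq_map => i /=.
by rewrite vertex_act c_act mulKVg.
Qed.

Lemma word_fun_long : finite_sset X ->
  exists N, forall w, (N < size w)%N -> word_fun w = 0.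
Proof.
(* An N-simplex has N+1 vertices, hence the bound N+1; naturality reduces every simplex to a
   nondegenerate one. *)
move=> /finite_sset_dim[N XN]; exists N.+1 => w Nw.
have [ww|/word_fun_stutter//] := boolP (stutterfree w).
apply: pw_evP => n x; rewrite word_funE ww rmorph0.
have [m [a [y [/XN mN ->]]]] := nondegenerate_root x.
rewrite word_poly_sset_op // word_poly_long ?rmorph0 //.
by rewrite size_map size_enum_ord; exact: leq_ltn_trans Nw.
Qed.

End WordFunctions.

(** * Pullback and trace between l^(X/G) and l^X *)

Section Descent.
Variables (l : comPzRingType) (gT : finGroupType) (X : sset) (act : sset_action gT X).
Local Notation A := (pwpoly l X).
Local Notation R := (pwpoly l (quot_sset act)).

Definition pull_fun (r : R) : A.
Proof.
exists (fun n x => pw_ev (X := quot_sset act) (orbit_of act x) r) => m n a x.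
by rewrite orbit_of_op; exact: (pw_val_op r a).
Defined.

Definition pull : alg_hom R A.
Proof. by exists pull_fun => [d r s|r s]; apply: pw_ext. Defined.

Lemma pull_inj : injective pull.
Proof.
move=> r s rs; apply: pw_evP => n O.
rewrite -(orbit_repK O) -[LHS]/(pw_ev (orbit_rep O) (pull r)).
by rewrite rs.
Qed.

Lemma orbit_sum_const (f : A) n (x y : X n) : orbit_of act x = orbit_of act y ->
  \sum_g pw_ev (act g n x) f = \sum_g pw_ev (act g n y) f.
Proof.
move=> /orbit_ofP[h ->]; rewrite [RHS](reindex_inj (mulIg h)).
by apply: eq_bigr => g _; rewrite sactM.
Qed.

(** The chosen orbit representatives need not be compatible with simplicial operators;
    [orbit_sum_const] makes the sum independent of them. *)
Definition trace_fun (f : A) : R.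
Proof.
exists (fun n O => \sum_g pw_ev (act g n (orbit_rep O)) f : simplex_ring l n).
move=> m n a O.
rewrite -[RHS]/(simplex_hom l a _) alg_hom_sum.
rewrite (@orbit_sum_const f m _ (sset_op a (orbit_rep O))); last first.
  by rewrite orbit_of_op !orbit_repK.
by apply: eq_bigr => g _; rewrite sset_map_op; exact: (pw_val_op f a).
Defined.

Fact trace_linear : linear trace_fun.
Proof.
move=> d f h; apply: pw_evP => n O.
rewrite -[RHS]/(d *: (\sum_g pw_ev (act g n (orbit_rep O)) f) +
  \sum_g pw_ev (act g n (orbit_rep O)) h) scaler_sumr -big_split.
by [].
Qed.

HB.instance Definition _ := GRing.isLinear.Build l A R *:%R trace_fun trace_linear.

Lemma pull_trace (f : A) : pull (trace_fun f) = \sum_g galg_act (pwpoly_galg l act) g f.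
Proof.
apply: pw_evP => n x; rewrite pw_ev_sum.
rewrite -[LHS]/(\sum_g pw_ev (act g n (orbit_rep (orbit_of act x))) f).
rewrite (@orbit_sum_const f n _ x) ?orbit_repK //.
(* A group element acts on functions through its inverse on simplices. *)
by rewrite (reindex_inj invg_inj); apply: eq_bigr.
Qed.

Lemma pull_act g r : galg_act (pwpoly_galg l act) g (pull r) = pull r.
Proof.
apply: pw_evP => n x.
rewrite -[LHS]/(pw_ev (X := quot_sset act) (orbit_of act (act g^-1%g n x)) r).
by rewrite orbit_of_act.
Qed.

End Descent.

Theorem corollary1p7 (l : comPzRingType) (gT : finGroupType) (X : sset)
    (act : sset_action gT X) (finX : finite_sset X) (free : free_action act)
    (kk : triangulated) (j : excisive_functor l kk) (jP : is_kk j) :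
  kk_equivalent j (crossed (pwpoly_galg l act)) (pwpoly l (quot_sset act)).
Proof.
have [_ j_stable _] := jP.
have [c c_act] := free_vertex_label free.
have [N f_long] := word_fun_long l c finX.
have [r rP] := galois_data (@word_fun_act l gT X act c c_act) (@word_fun_letters l gT X c)
  (@word_fun_stutter l gT X c) (@word_fun_antipode l gT X c) f_long.
(* A dummy pair makes the list nonempty, as the Galois data are indexed by ['I_n.+1]. *)
pose r0 := (0, 0) :: r.
pose x (i : 'I_(size r).+1) : pwpoly_galg l act := (nth 0 r0 i).1.
pose y (i : 'I_(size r).+1) : pwpoly_galg l act := (nth 0 r0 i).2.
pose tr : {linear pwpoly l X -> pwpoly l (quot_sset act)} := @trace_fun l gT X act.
have xyP (g : gT) : \sum_i x i ** galg_act (pwpoly_galg l act) g (y i) =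
    if g == 1%g then pw_one l X else 0.
  rewrite -[RHS]rP; transitivity (\sum_(p <- r0) p.1 * galg_act (pwpoly_galg l act) g p.2).
    by rewrite [RHS](big_nth 0) big_mkord.
  by rewrite big_cons mul0r add0r.
have pull1 : pull l act (pw_one l _) = pw_one l X by exact: pw_ext.
have tr_c : tr (word_fun l c [:: 1%g]) = pw_one l _.
  (* The translates of f_(1) are the f_(g), which add up to 1. *)
  apply: (@pull_inj _ _ _ act); rewrite pull1 pull_trace -[RHS](word_fun_letters l c).
  by apply: eq_bigr => g _; rewrite (word_fun_act l c_act) /= mulg1.
exact: (galois_morita (A := pwpoly_galg l act) (@pw_mulC l X) (@pw_mul1 l X)
  (@pull_inj _ _ _ act) pull1 (@pull_act _ _ _ act) (@pull_trace _ _ _ act)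
  xyP tr_c j_stable).
Qed.
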